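(* Let $H$ be a finite group, let $G=(V,E)$ be a finite multigraph, let $\beta:E\to H$ be an $H$-voltage assignment on $G$ (giving the voltage graph $G_\beta$), and let $\pi:\tilde G\to G$ be the associated regular covering. Then there is a short exact sequence of finite abelian groups $$0 \longrightarrow K(G_{\beta}) \longrightarrow K(\tilde{G}) \longrightarrow K(G) \longrightarrow 0,$$ in which $K(\tilde G)\to K(G)$ is the surjection induced by $\pi$, and this sequence splits when restricted to $p$-primary components for every prime $p$ not dividing $|H|$. In particular, the numbers $|K(\tilde G)|$ and $|K(G)|$ of maximal forests of $\tilde G$ and $G$ are related by the factor $|K(G_\beta)|$: $$|K(\tilde{G})|=|K(G_\beta)| \cdot |K(G)|.$$
   Context: Multigraphs $G=(V,E)$ are finite and undirected; multiple edges and self-loops are allowed. Fix an arbitrary orientation $e=(u,v)$ of each edge. Let $\partial_G:\mathbb{Z}^E\to\mathbb{Z}^V$ be the $\mathbb{Z}$-linear map $e=(u,v)\mapsto u-v$, and $\partial_G^t:\mathbb{Z}^V\to\mathbb{Z}^E$ its transpose. The critical group of $G$ is $$K(G):=\mathbb{Z}^E/(\operatorname{im}\partial_G^t+\ker\partial_G)\;\cong\;\operatorname{im}\partial_G/\operatorname{im}\partial_G\partial_G^t$$ (the isomorphism being induced by $\partial_G$). It is a finite abelian group whose cardinality is the number of maximal forests of $G$. Voltage assignment and regular covering: an $H$-voltage assignment (or $H$-voltage graph) $G_\beta$ is a map $\beta:E\to H$. The associated regular covering $\pi:\tilde G\to G$ has $\tilde G=(\tilde V,\tilde E)$ with $\tilde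 V=\{v_h\}_{v\in V,h\in H}$ and $\tilde E=\{e_h=(u_h,v_{\beta(e)h})\}_{e=(u,v)\in E,\,h\in H}$, and $\pi$ forgets subscripts: $v_h\mapsto v$, $e_h\mapsto e$. The map $\mathbb{Z}^{\tilde E}\to\mathbb{Z}^E$, $e_h\mapsto e$, induces a surjection $K(\tilde G)\to K(G)$. Voltage graph critical group: $\mathbb{Z}H$ is the group algebra with $\mathbb{Z}$-basis $\{T_h\}_{h\in H}$ and $T_{h_1}T_{h_2}=T_{h_1h_2}$; let $c=\sum_{h\in H}T_h$ and let $\overline{\mathbb{Z}H}:=\mathbb{Z}H/\mathbb{Z}c$ be the reduced group algebra, with $\overline{T}_h$ the image of $T_h$ and with the anti-automorphism $*$ given by $\overline{T}_h\mapsto\overline{T}_{h^{-1}}$. Let $\overline{\mathbb{Z}H}^E$ and $\overline{\mathbb{Z}H}^V$ be the free right $\overline{\mathbb{Z}H}$-modules on $E$ and $V$. Let $\overline{\partial}_{G_\beta}:\overline{\mathbb{Z}H}^E\to\overline{\mathbb{Z}H}^V$ be the right-module map with $e=(u,v)\mapsto u-v\overline{T}_{\beta(e)}$, and let $\overline{\partial}_{G_\beta}^*:\overline{\mathbb{Z}H}^V\to\overline{\mathbb{Z}H}^E$ be the right-module map whose matrix is obtained from that of $\overline{\partial}_{G_\beta}$ by transposing and applying $*$ to every entry (matrices act on column vectors by left multiplication). Then $$K(G_\beta):=\overline{\mathbb{Z}H}^E/(\operatorname{im}\overline{\partial}_{G_\beta}^*+\ker\overline{\partial}_{G_\beta})\;\cong\;\operatorname{im}\overline{\partial}_{G_\beta}/\operatorname{im}\overline{\partial}_{G_\beta}\overline{\partial}_{G_\beta}^*.$$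 *)

(* Defs.v *)
From HB Require Import structures.
From mathcomp Require Import all_boot all_order all_fingroup all_algebra.
From mathcomp Require Import finmap.
From mathcomp Require Import boolp classical_sets functions cardinality.
Set Implicit Arguments.
Unset Strict Implicit.
Unset Printing Implicit Defensive.
Import GRing.Theory.
Local Open Scope ring_scope.
Local Open Scope quotient_scope.

(* An edge e is oriented from source e to target e; parallel edges and
   self-loops are allowed. *)
Record multigraph := Multigraph {
  vertex : finType;
  edge : finType;
  source : edge -> vertex;
  target : edge -> vertex
}.

Definition covering (H : finGroupType) (G : multigraph) (beta : edge G -> H) :=
  @Multigraph (vertex G * H)%type (edge G * H)%type
    (fun e => (source e.1, e.2)) (fun e => (target e.1, (beta e.1 * e.2)%g)).

(* Maximal forests.  A dart (e, false) traverses e along its orientation,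
   (e, true) traverses it backwards.  A cycle is a closed walk along pairwise
   distinct edges through pairwise distinct vertices; a self-loop is a cycle of
   length 1 and a pair of parallel edges a cycle of length 2. *)
Section Forests.
Variable G : multigraph.

Definition dart_start (d : edge G * bool) :=
  if d.2 then target d.1 else source d.1.
Definition dart_end (d : edge G * bool) :=
  if d.2 then source d.1 else target d.1.

Definition graph_cycle (s : seq (edge G * bool)) : bool :=
  [&& (0 < size s)%N, uniq (map fst s), uniq (map dart_start s)
    & path.cycle (fun d d' => dart_end d == dart_start d') s].

Definition forest (F : {set edge G}) : bool :=
  `[< ~ exists2 s, graph_cycle s & all (fun d => d.1 \in F) s >].

Definition num_maximal_forests : nat := #|[set F | maxset forest F]|.

End Forests.

(* A matrix D : V -> E -> R acts on column vectors by left multiplication; over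
   a noncommutative R this is the map of free right R-modules R^E -> R^V with
   matrix D. *)
Section CriticalGroup.
Variables (R : pzRingType) (star : R -> R).

Definition mulmxv (I J : finType) (M : I -> J -> R) (x : {ffun J -> R}) :
  {ffun I -> R} := [ffun i => \sum_j M i j * x j].

Lemma mulmxv_is_zmod_morphism I J M : zmod_morphism (@mulmxv I J M).
Proof.
move=> x y; apply/ffunP=> i; rewrite !ffunE -sumrB.
by apply: eq_bigr => j _; rewrite !ffunE mulrBr.
Qed.

HB.instance Definition _ I J M :=
  GRing.isZmodMorphism.Build _ _ (@mulmxv I J M) (mulmxv_is_zmod_morphism M).

Definition adjoint_mx (I J : finType) (M : I -> J -> R) (j : J) (i : I) : R :=
  star (M i j).

Variables (V E : finType) (D : V -> E -> R).

Definition critical_relations : {pred {ffun E -> R}} := fun x =>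
  `[< exists y z, mulmxv D z = 0 /\ x = mulmxv (adjoint_mx D) y + z >].

Lemma critical_relations_closed : zmod_closed critical_relations.
Proof.
split=> [|x1 x2 /asboolP[y1 [z1 [Dz1 ->]]] /asboolP[y2 [z2 [Dz2 ->]]]].
  by apply/asboolP; exists 0, 0; rewrite !raddf0 addr0.
apply/asboolP; exists (y1 - y2), (z1 - z2); split.
  by rewrite mulmxv_is_zmod_morphism Dz1 Dz2 subr0.
by rewrite mulmxv_is_zmod_morphism opprD addrACA.
Qed.

HB.instance Definition _ :=
  GRing.isZmodClosed.Build _ critical_relations critical_relations_closed.

(* R^E / (im D* + ker D) *)
Definition critical_quotient : zmodType :=
  [the zmodType of Quotient.quot [the zmodClosed _ of critical_relations]].

End CriticalGroup.

Section GraphCriticalGroup.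

Definition boundary (G : multigraph) (v : vertex G) (e : edge G) : int :=
  (v == source e)%:R - (v == target e)%:R.

Definition critical_group (G : multigraph) : zmodType :=
  critical_quotient id (@boundary G).

Definition critical_class (G : multigraph) (x : {ffun edge G -> int}) :
  critical_group G := \pi x.

(* Z^E~ -> Z^E, e_h |-> e *)
Definition covering_push (H : finGroupType) (G : multigraph)
    (beta : edge G -> H) (x : {ffun edge (covering beta) -> int}) :
  {ffun edge G -> int} := [ffun e => \sum_h x (e, h)].

End GraphCriticalGroup.

(* Z H, an integer function x standing for \sum_h x(h) T_h.  The product below is
   the convolution, not the pointwise product of {ffun H -> int}. *)
Section GroupAlgebra.
Variable H : finGroupType.

Definition group_algebra := {ffun H -> int}.
HB.instance Definition _ := GRing.Zmodule.on group_algebra.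

Definition ga_basis (h : H) : group_algebra := [ffun k => (k == h)%:R].

Definition ga_mul (x y : group_algebra) : group_algebra :=
  [ffun h => \sum_k x k * y (k^-1 * h)%g].

Lemma ga_mulA : associative ga_mul.
Proof.
move=> x y z; apply/ffunP=> h; rewrite !ffunE.
under eq_bigr do rewrite ffunE mulr_sumr.
under [RHS]eq_bigr do rewrite ffunE mulr_suml.
rewrite [RHS]exchange_big; apply: eq_bigr => k _.
rewrite [RHS](reindex_inj (mulgI k)); apply: eq_bigr => l _.
by rewrite mulrA mulKg invMg mulgA.
Qed.

Lemma ga_mul1r : left_id (ga_basis 1) ga_mul.
Proof.
move=> x; apply/ffunP=> h; rewrite !ffunE (bigD1 1%g) //= ffunE eqxx mul1r.
by rewrite invg1 mul1g big1 ?addr0 // => k /negPf nk; rewrite ffunE nk mul0r.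
Qed.

Lemma ga_mulr1 : right_id (ga_basis 1) ga_mul.
Proof.
move=> x; apply/ffunP=> h; rewrite !ffunE (bigD1 h) //= ffunE mulVg eqxx mulr1.
rewrite big1 ?addr0 // => k nk; rewrite ffunE -eq_mulVg1.
by rewrite (negPf nk) mulr0.
Qed.

Lemma ga_mulDl : left_distributive ga_mul +%R.
Proof.
move=> x y z; apply/ffunP=> h; rewrite !ffunE -big_split /=.
by apply: eq_bigr => k _; rewrite !ffunE mulrDl.
Qed.

Lemma ga_mulDr : right_distributive ga_mul +%R.
Proof.
move=> x y z; apply/ffunP=> h; rewrite !ffunE -big_split /=.
by apply: eq_bigr => k _; rewrite !ffunE mulrDr.
Qed.

HB.instance Definition _ := GRing.Zmodule_isPzRing.Build group_algebra
  ga_mulA ga_mul1r ga_mulr1 ga_mulDl ga_mulDr.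

Lemma ga_basisM g h : ga_basis g * ga_basis h = ga_basis (g * h).
Proof.
apply/ffunP=> k; rewrite [LHS]ffunE (bigD1 g) //= !ffunE eqxx mul1r.
rewrite big1 ?addr0 => [|l /negPf nl]; last by rewrite !ffunE nl mul0r.
by rewrite -(inj_eq (mulgI g)) mulKVg.
Qed.

Lemma ga_mulrzE (x : group_algebra) (n : int) h : (x *~ n) h = x h *~ n.
Proof.
by case: n => n; rewrite ?NegzE ?mulrNz ?ffunE -?pmulrn ffunMnE.
Qed.

Lemma ga_sumE (x : group_algebra) : x = \sum_h ga_basis h *~ x h.
Proof.
apply/ffunP=> k; rewrite sum_ffunE (bigD1 k) //= big1 ?addr0.
  by rewrite ga_mulrzE ffunE eqxx intz.
by move=> h /negPf nh; rewrite ga_mulrzE ffunE eq_sym nh mul0rz.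
Qed.

Definition ga_star (x : group_algebra) : group_algebra := [ffun h => x h^-1%g].

Lemma ga_star_basis h : ga_star (ga_basis h) = ga_basis h^-1.
Proof. by apply/ffunP=> k; rewrite !ffunE (inv_eq invgK). Qed.

Definition ga_norm : group_algebra := \sum_h ga_basis h.

Definition norm_multiples : {pred group_algebra} := fun x =>
  `[< exists n : int, x = ga_norm *~ n >].

Lemma norm_multiplesP (x : group_algebra) :
  reflect (exists n : int, forall h, x h = n) (x \in norm_multiples).
Proof.
have normE (n : int) h : (ga_norm *~ n) h = n.
  rewrite ga_mulrzE sum_ffunE (bigD1 h) //= ffunE eqxx big1 ?addr0 ?intz //.
  by move=> k /negPf nk; rewrite ffunE eq_sym nk.
apply: (iffP (asboolP _)) => -[n xn]; exists n; first by move=> h; rewrite xn.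
by apply/ffunP=> h; rewrite xn normE.
Qed.

Lemma norm_multiples_closed : zmod_closed norm_multiples.
Proof.
split=> [|x y /norm_multiplesP[m xm] /norm_multiplesP[n yn]].
  by apply/norm_multiplesP; exists 0 => h; rewrite ffunE.
by apply/norm_multiplesP; exists (m - n) => h; rewrite !ffunE xm yn.
Qed.

HB.instance Definition _ :=
  GRing.isZmodClosed.Build _ norm_multiples norm_multiples_closed.

Lemma norm_multiplesMl a x : x \in norm_multiples -> a * x \in norm_multiples.
Proof.
case/norm_multiplesP=> n xn; apply/norm_multiplesP.
exists (\sum_k a k * n) => h; rewrite ffunE.
by apply: eq_bigr => k _; rewrite xn.
Qed.

Lemma norm_multiplesMr a x : x \in norm_multiples -> x * a \in norm_multiples.
Proof.
case/norm_multiplesP=> n xn; apply/norm_multiplesP.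
exists (\sum_k n * a k) => h; rewrite ffunE.
rewrite [RHS](reindex_inj invg_inj) [RHS](reindex_inj (mulgI h^-1%g)) /=.
by apply: eq_bigr => k _; rewrite xn invMg invgK.
Qed.

(* The reduced group algebra Z H / Z c; it is the zero ring when H is trivial. *)
Definition reduced_algebra :=
  Quotient.quot [the zmodClosed group_algebra of norm_multiples].
HB.instance Definition _ := GRing.Zmodule.on reduced_algebra.
HB.instance Definition _ := EqQuotient.on reduced_algebra.

Definition reduced_proj (x : group_algebra) : reduced_algebra := \pi x.

Lemma reduced_projP (x y : group_algebra) :
  reflect (reduced_proj x = reduced_proj y) (x - y \in norm_multiples).
Proof. by rewrite Quotient.idealrBE; apply: eqP. Qed.

Lemma reduced_proj_is_zmod_morphism : zmod_morphism reduced_proj.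
Proof. by move=> x y; rewrite /reduced_proj raddfB. Qed.

HB.instance Definition _ := GRing.isZmodMorphism.Build _ _ reduced_proj
  reduced_proj_is_zmod_morphism.

Definition reduced_lift (x : reduced_algebra) : group_algebra :=
  generic_quotient.repr x.

Lemma reduced_liftK : cancel reduced_lift reduced_proj.
Proof. exact: reprK. Qed.

Definition reduced_mul (x y : reduced_algebra) : reduced_algebra :=
  reduced_proj (reduced_lift x * reduced_lift y).

Lemma reduced_mulE (x y : group_algebra) :
  reduced_mul (reduced_proj x) (reduced_proj y) = reduced_proj (x * y).
Proof.
have D (z : group_algebra) : reduced_lift (reduced_proj z) - z \in norm_multiples.
  by apply/reduced_projP; rewrite reduced_liftK.
apply/reduced_projP; set x' := reduced_lift _; set y' := reduced_lift _.
rewrite -[x' * y'](subrK (x * y')) -mulrBl -addrA -mulrBr.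
by apply: rpredD; [apply: norm_multiplesMr | apply: norm_multiplesMl]; apply: D.
Qed.

Lemma reduced_mulA : associative reduced_mul.
Proof.
move=> x y z; rewrite -[x]reduced_liftK -[y]reduced_liftK -[z]reduced_liftK.
by rewrite !reduced_mulE mulrA.
Qed.

Lemma reduced_mul1r : left_id (reduced_proj 1) reduced_mul.
Proof. by move=> x; rewrite -[x]reduced_liftK reduced_mulE mul1r. Qed.

Lemma reduced_mulr1 : right_id (reduced_proj 1) reduced_mul.
Proof. by move=> x; rewrite -[x]reduced_liftK reduced_mulE mulr1. Qed.

Lemma reduced_mulDl : left_distributive reduced_mul +%R.
Proof.
move=> x y z; rewrite -[x]reduced_liftK -[y]reduced_liftK -[z]reduced_liftK.
by rewrite -raddfD !reduced_mulE mulrDl raddfD.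
Qed.

Lemma reduced_mulDr : right_distributive reduced_mul +%R.
Proof.
move=> x y z; rewrite -[x]reduced_liftK -[y]reduced_liftK -[z]reduced_liftK.
by rewrite -raddfD !reduced_mulE mulrDr raddfD.
Qed.

HB.instance Definition _ := GRing.Zmodule_isPzRing.Build reduced_algebra
  reduced_mulA reduced_mul1r reduced_mulr1 reduced_mulDl reduced_mulDr.

Lemma reduced_projM (x y : group_algebra) :
  reduced_proj (x * y) = reduced_proj x * reduced_proj y.
Proof. by rewrite -reduced_mulE. Qed.

Definition reduced_basis (h : H) : reduced_algebra :=
  reduced_proj (ga_basis h).

Definition reduced_star (x : reduced_algebra) : reduced_algebra :=
  reduced_proj (ga_star (reduced_lift x)).

Lemma reduced_starE (x : group_algebra) :
  reduced_star (reduced_proj x) = reduced_proj (ga_star x).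
Proof.
have /norm_multiplesP[n xn] : reduced_lift (reduced_proj x) - x \in norm_multiples.
  by apply/reduced_projP; rewrite reduced_liftK.
apply/reduced_projP/norm_multiplesP; exists n => h.
by rewrite !ffunE -(xn h^-1%g) !ffunE.
Qed.

Lemma reduced_star_basis h :
  reduced_star (reduced_basis h) = reduced_basis h^-1.
Proof. by rewrite reduced_starE ga_star_basis. Qed.

End GroupAlgebra.

Section VoltageCriticalGroup.
Variables (H : finGroupType) (G : multigraph) (beta : edge G -> H).

Definition voltage_boundary (v : vertex G) (e : edge G) : reduced_algebra H :=
  (v == source e)%:R - (v == target e)%:R * reduced_basis (beta e).

Definition voltage_critical_group : zmodType :=
  critical_quotient (@reduced_star H) voltage_boundary.

End VoltageCriticalGroup.

Section PrimaryComponent.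
Variable p : nat.

Definition p_primary (A : zmodType) : {pred A} := fun x =>
  `[< exists k : nat, x *+ (p ^ k) = 0 >].

Lemma p_primary_closed A : zmod_closed (@p_primary A).
Proof.
split=> [|x y /asboolP[k xk] /asboolP[l yl]].
  by apply/asboolP; exists 0%N; rewrite mul0rn.
apply/asboolP; exists (k + l)%N; rewrite mulrnBl expnD.
by rewrite mulrnA xk mul0rn mulnC mulrnA yl mul0rn subr0.
Qed.

HB.instance Definition _ A :=
  GRing.isZmodClosed.Build A (@p_primary A) (@p_primary_closed A).

Record primary_part (A : zmodType) := PrimaryPart {
  primary_val : A;
  _ : p_primary primary_val
}.

HB.instance Definition _ A := [isSub for @primary_val A].
HB.instance Definition _ A := [Choice of primary_part A by <:].
HB.instance Definition _ A := [SubChoice_isSubZmodule of primary_part A by <:].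

Variables (A B : zmodType) (f : {additive A -> B}).

Lemma primary_map_subproof (x : primary_part A) : p_primary (f (val x)).
Proof.
case: x => x /= /asboolP[k xk]; apply/asboolP; exists k.
by rewrite -raddfMn xk raddf0.
Qed.

Definition primary_map (x : primary_part A) : primary_part B :=
  PrimaryPart (primary_map_subproof x).

Lemma primary_map_is_zmod_morphism : zmod_morphism primary_map.
Proof. by move=> x y; apply: val_inj; rewrite /= !raddfB. Qed.

HB.instance Definition _ := GRing.isZmodMorphism.Build _ _ primary_map
  primary_map_is_zmod_morphism.

End PrimaryComponent.
Arguments primary_map p {A B} f x.

Section ExactSequences.
Variables (A B C : zmodType) (i : {additive A -> B}) (q : {additive B -> C}).

Definition short_exact : Prop :=
  [/\ injective i,
      forall y, q y = 0 <-> exists x, i x = y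
    & forall z, exists y, q y = z].

Definition split_short_exact : Prop :=
  short_exact /\ exists s : {additive C -> B}, cancel s q.

End ExactSequences.

Definition finite_group (A : zmodType) : Prop := finite_set [set: A].

(* Meaningful when finite_group A holds; 0 otherwise. *)
Definition group_order (A : zmodType) : nat := #|` fset_set [set: A]|.

(* Main.v *)
Require Import Defs.
From HB Require Import structures.
From mathcomp Require Import finmap.
From mathcomp Require Import classical_sets cardinality.
From mathcomp Require Import all_boot all_order all_fingroup all_algebra.
From mathcomp Require Import boolp zify ring.
Set Implicit Arguments.
Unset Strict Implicit.
Unset Printing Implicit Defensive.
Import GRing.Theory Num.Theory.
Local Open Scope ring_scope.

(** Write bd for the boundary map of a graph and cobd for its transpose, so that
K(G) is im bd modulo im (bd cobd).

Counting forests.  A maximal forest T is independent and spanning for cuts: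
restriction to T maps the cut lattice im cobd isomorphically onto Z^T
([forest_potential], [cut_eq0]).  Pairing with the resulting basis N of
fundamental cuts identifies K(G) with the cokernel of the Gram matrix of N,
whose order is the determinant ([card_quotient_det]).  By the Cauchy-Binet
formula that determinant is the sum of the squares of the maximal minors of N,
and such a minor is invertible over the integers when its columns form a maximal
forest and zero otherwise, because a cycle is a linear relation between columns
([sqr_det_selection]).  The same basis shows that im bd and im cobd are
saturated: an integral vector with a nonzero multiple in one of them lies in it
([bd_saturated], [cobd_saturated]).

The exact sequence.  Summation over the fibres of the covering and its transpose
[pull] commute with bd and cobd, hence induce q : K(G~) -> K(G) and
t : K(G) -> K(G~) with q t = |H|.  On p-primary parts with p prime to |H| the
map t, divided by |H|, is a section of q ([primary_split]).

Reduction modulo the norm element kills exactly the vectors [pull x], so by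
saturation K(G_beta) is im bd~ modulo the image of
  M = [bd~ cobd~ | pull bd],
that is, the cokernel of t ([voltage_class_eq0]).  The kernel of q is not this
group but its dual, presented by the transpose
  M^t = (bd~ cobd~, cobd fiber_sum).
Both groups are finite, K(G_beta) is the torsion of coker M, and ker q is the
torsion of coker M^t.  A matrix and its transpose have the same Smith
normal form, so these torsion groups are isomorphic, although not canonically
([smith_adjoint]); the isomorphism is the injection of the exact sequence
([covering_short_exact]). *)

(** * Abelian groups *)

(** Homomorphisms between quotients are obtained below from relations between
representatives; compatibility with subtraction reduces single-valuedness to
the fibre over 0. *)
Lemma additive_of_relation (A B : zmodType) (R : A -> B -> Prop) :
    (forall a, exists b, R a b) ->
    (forall a a' b b', R a b -> R a' b' -> R (a - a') (b - b')) ->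
    (forall b, R 0 b -> b = 0) ->
  exists f : {additive A -> B}, forall a b, R a b <-> f a = b.
Proof.
move=> /choice[f Rf] RB R0.
have fE a b : R a b <-> f a = b.
  split=> [Rab|<-//]; apply/eqP; rewrite -subr_eq0; apply/eqP/R0.
  by rewrite -(subrr a); apply: RB.
have fB : zmod_morphism f by move=> a a'; apply/fE/RB.
pose fM := GRing.isZmodMorphism.Build A B f fB.
pose fA : {additive A -> B} := HB.pack f fM.
by exists fA.
Qed.

Lemma finite_group_surj (A : Type) (B : zmodType) (f : A -> B) :
  finite_set (@classical_sets.setT A) -> (forall b, exists a, f a = b) ->
    finite_group B.
Proof.
move=> finA surj_f; rewrite /finite_group.
suff -> : @classical_sets.setT B = classical_sets.image classical_sets.setT f.
  exact: finite_image.
by apply/seteqP; split=> // b _; have [a <-] := surj_f b; exists a.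
Qed.

Lemma finite_group_inj (A B : zmodType) (f : A -> B) :
  injective f -> finite_group B -> finite_group A.
Proof.
move=> inj_f finB.
have /choice[g gP] : forall b, exists a, (exists a', f a' = b) -> f a = b.
  by move=> b; have [[a <-]|] := pselect (exists a, f a = b);
    [exists a | exists 0].
by apply: (finite_group_surj (f := g) finB) => a; exists (f a);
  apply/inj_f/gP; exists a.
Qed.

Lemma finite_group_enum (A : zmodType) : finite_group A ->
  exists (T : finType) (f : T -> A), bijective f /\ #|T| = group_order A.
Proof.
move=> finA; pose T : finType := fset_set (@classical_sets.setT A).
exists T, (fun x : T => \val x); split; last by rewrite -cardfE.
have inT a : a \in fset_set (@classical_sets.setT A).
  by rewrite in_fset_set ?classical_sets.inE.
exists (fun a => [` inT a]%fset) => [x|//]; exact: val_inj.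
Qed.

Lemma finite_group_bij (A : zmodType) (T : finType) (f : T -> A) :
  bijective f -> finite_group A /\ group_order A = #|T|.
Proof.
move=> bij_f; have [g fK gK] := bij_f.
have finA : finite_group A.
  have finT : finite_set (@classical_sets.setT T) by apply: finite_finset.
  by apply: (finite_group_surj finT (f := f)) => a; exists (g a).
have [T' [f' [bij_f' <-]]] := finite_group_enum finA.
split=> //; have [g' f'K g'K] := bij_f'; apply: (@bij_eq_card _ _ (g \o f')).
by apply: bij_comp => //; exists f.
Qed.

(** A set-theoretic section s of q gives the bijection (a, c) |-> i a + s c.
*)
Lemma group_order_exact (A B C : zmodType) (i : {additive A -> B})
    (q : {additive B -> C}) :
    short_exact i q -> finite_group A -> finite_group C ->
  group_order B = (group_order A * group_order C)%N.
Proof.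
move=> [inj_i ker_q /choice[s sK]] /finite_group_enum[T [f [bij_f <-]]].
move=> /finite_group_enum[U [g [bij_g <-]]].
rewrite -card_prod.
have [f' fK f'K] := bij_f; have [g' gK g'K] := bij_g.
have /choice[r rP] : forall b, exists a, i a = b - s (q b).
  by move=> b; apply/ker_q; rewrite raddfB /= sK subrr.
have qi a : q (i a) = 0 by apply/ker_q; exists a.
have h_bij : bijective (fun x : T * U => i (f x.1) + s (g x.2)).
  exists (fun b => (f' (r b), g' (q b))) => [[t u]|b] /=.
    rewrite raddfD /= qi sK add0r gK; congr (_, _); rewrite -[RHS]fK.
    congr f'; apply: inj_i; rewrite rP raddfD /= qi sK add0r addrK //.
  by rewrite f'K g'K rP subrK.
by have [] := finite_group_bij h_bij.
Qed.

Lemma finite_group_torsion (A : zmodType) (a : A) :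
  finite_group A -> exists2 n : nat, (0 < n)%N & a *+ n = 0.
Proof.
move=> /finite_group_enum[T [f [[g _ gK] _]]].
have : ~~ injectiveb (fun m : 'I_#|T|.+1 => g (a *+ m)).
  apply/injectiveP => /leq_card; by rewrite card_ord ltnn.
case/injectivePn => m [n ne_mn /(can_inj gK) eq_mn].
wlog lt_mn : m n ne_mn eq_mn / (m < n)%N.
  move=> wlog_mn; have [lt|lt|/val_inj eq] := ltngtP m n.
  - exact: wlog_mn lt.
  - by apply: wlog_mn lt => //; rewrite eq_sym.
  - by rewrite eq eqxx in ne_mn.
exists (n - m)%N; first by rewrite subn_gt0.
by rewrite mulrnBr ?(ltnW lt_mn) // eq_mn subrr.
Qed.

(** An integer prime to p is invertible modulo each power of p, hence acts
bijectively on a p-primary group. *)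
Lemma primary_mulrn_bij p n (A : zmodType) (a : primary_part p A) :
  prime p -> ~~ (p %| n)%N ->
  (exists b : primary_part p A, b *+ n = a) /\ (a *+ n = 0 -> a = 0).
Proof.
move=> p_pr p'n; have [k ak0] : exists k, a *+ (p ^ k) = 0.
  have /asboolP[k ak0] : p_primary p (val a) by case: a.
  by exists k; apply: val_inj; rewrite raddfMn ak0 raddf0.
have cop_n : coprime n (p ^ k) by rewrite coprime_sym coprimeXl //
  prime_coprime.
have [m mP] : exists m, (m * n = 1 %[mod p ^ k])%N.
  have n_gt0 : (0 < n)%N by case: (n) p'n => //; rewrite dvdn0.
  have [u v uP _] := egcdnP (p ^ k) n_gt0; exists u.
  by rewrite uP (eqP cop_n) modnMDl.
have mulr_mod r : a *+ r = a *+ (r %% p ^ k).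
  by rewrite {1}(divn_eq r (p ^ k)) mulrnDr mulnC mulrnA ak0 mul0rn add0r.
have mn1 : a *+ (m * n) = a by rewrite mulr_mod mP -mulr_mod.
by split=> [|an0]; [exists (a *+ m);
  rewrite -mulrnA | rewrite -mn1 mulnC mulrnA an0 mul0rn].
Qed.

(** The section is t divided by n, a division that is unique on p-primary
parts. *)
Lemma primary_split p n (A B C : zmodType) (i : {additive A -> B})
    (q : {additive B -> C}) (t : {additive C -> B}) :
    prime p -> ~~ (p %| n)%N -> short_exact i q ->
    (forall c, q (t c) = c *+ n) ->
  split_short_exact (primary_map p i) (primary_map p q).
Proof.
move=> p_pr p'n [inj_i ker_q surj_q] qt.
have [s sP] : exists s : {additive primary_part p C -> primary_part p B},
    forall c b, (exists2 c', c' *+ n = c & primary_map p t c' = b) <-> s c = b.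
  apply: additive_of_relation => [c|c1 c2 b1 b2|b].
  - by have [[c' <-] _] := primary_mulrn_bij c p_pr p'n;
      exists (primary_map p t c'), c'.
  - move=> [c1' <- <-] [c2' <- <-]; exists (c1' - c2');
      first by rewrite mulrnBl.
    by rewrite raddfB.
  move=> [c' c'n0 <-]; have [_ /(_ c'n0)->] := primary_mulrn_bij c' p_pr p'n.
  by rewrite raddf0.
have sK : cancel s (primary_map p q).
  move=> c; have /sP[c' <- <-] := erefl (s c).
  by apply: val_inj; rewrite raddfMn /= qt.
split; last by exists s.
split=> [a a' /(congr1 val)/inj_i/val_inj // | b | c]; last by exists (s c);
  apply: sK.
split=> [/(congr1 val)/ker_q[a i_a]|[a <-]]; last first.
  by apply: val_inj; apply/ker_q; exists (val a).
have pr_a : p_primary p a.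
  have /asboolP[k bk0] : p_primary p (val b) by case: (b).
  by apply/asboolP; exists k; apply: inj_i; rewrite raddfMn i_a bk0 raddf0.
by exists (PrimaryPart pr_a); apply: val_inj.
Qed.

(** * Smith normal form *)

Definition rect_diag m n (a : nat -> int) : 'M[int]_(m, n) :=
  \matrix_(i, j) (a i *+ (i == j :> nat)).

Lemma tr_rect_diag m n a : (rect_diag m n a)^T = rect_diag n m a.
Proof. by apply/matrixP => i j; rewrite !mxE eq_sym; case: eqP => // ->. Qed.

Lemma mul_rect_diag m n p a b :
  rect_diag m n a *m rect_diag n p b =
  rect_diag m p (fun i => a i * b i *+ (i < n)%N).
Proof.
apply/matrixP => i j; rewrite !mxE.
have [lt_in|le_ni] := ltnP i n.
  rewrite (bigD1 (Ordinal lt_in)) //= big1 => [|k]; rewrite !mxE /= ?eqxx.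
    by rewrite addr0 mulr1n mulrnAr.
  by rewrite -val_eqE /= eq_sym => /negPf->; rewrite mul0r.
rewrite big1 => [|k _]; first by rewrite mul0rn.
by rewrite !mxE gtn_eqF ?mul0r // (leq_trans (ltn_ord k)).
Qed.

Lemma square_rect_diagE n p a (w : 'M_(n, p)) i j :
  (rect_diag n n a *m w) i j = a i * w i j.
Proof.
rewrite mxE (bigD1 i) //= big1 => [|k /negPf ne_ki].
  by rewrite addr0 mxE eqxx mulr1n.
by rewrite mxE eq_sym val_eqE ne_ki mul0r.
Qed.

(** The indicator of the nonzero diagonal entries; its diagonal matrix
projects onto the torsion coordinates of the cokernel of the diagonal matrix
d. *)
Definition nonzero_support (d : nat -> int) (i : nat) : int := (d i != 0)%:R.

(** A vector that is torsion modulo the image of a diagonal matrix has no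
component along the zero diagonal entries, so the projection fixes it. *)
Lemma rect_diag_support m n d p (u : 'M_(m, p)) (w : 'M_(n, p)) (k : int) :
    k != 0 -> k *: u = rect_diag m n d *m w ->
  rect_diag m n (nonzero_support d) *m (rect_diag n m (nonzero_support d) *m u)
    = u.
Proof.
move=> nz_k def_u; rewrite mulmxA mul_rect_diag; apply/matrixP => i j.
have /matrixP/(_ i j) := def_u.
rewrite square_rect_diagE !mxE /nonzero_support.
case: eqP => [d0 | _ ku].
  rewrite big1 => [/eqP|l _]; last by rewrite mxE d0 mul0rn mul0r.
  by rewrite mulf_eq0 (negPf nz_k) => /eqP->; rewrite mulr0.
have [lt_in|le_ni] := ltnP i n; first by rewrite !mul1r.
move/eqP: ku; rewrite big1 => [|l _]; last first.
  by rewrite mxE gtn_eqF ?mul0r // (leq_trans (ltn_ord l)).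
by rewrite mulf_eq0 (negPf nz_k) => /eqP->; rewrite mulr0.
Qed.

(** A matrix and its transpose have cokernels with isomorphic torsion. If M =
L S R with S diagonal, then M^t = R^t S^t L^t, and the rectangular partial
identity P on the nonzero diagonal entries of S exchanges the torsion of coker
S and of coker S^t; conjugating P by the unimodular factors gives F and F'. *)
Lemma smith_transpose m n (M : 'M[int]_(m, n)) :
  exists (F : 'M_(n, m)) (F' : 'M_(m, n)),
    [/\ exists A, F *m M = M^T *m A,
        exists A, F' *m M^T = M *m A,
        forall (x : 'cV_m) y (k : int), k != 0 -> k *: x = M *m y ->
          F' *m (F *m x) = x
      & forall (z : 'cV_n) y (k : int), k != 0 -> k *: z = M^T *m y ->
          F *m (F' *m z) = z].
Proof.
have [L uL [R uR [d _]]] := int_Smith_normal_form M.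
rewrite -[\matrix_(i, j) _]/(rect_diag m n (fun i => d`_i));
  set S := rect_diag m n _.
move=> defM; pose s := nonzero_support (fun i => d`_i).
have uLT : L^T \in unitmx by rewrite unitmx_tr.
have uRT : R^T \in unitmx by rewrite unitmx_tr.
have defMT : M^T = R^T *m rect_diag n m (fun i => d`_i) *m L^T.
  by rewrite defM !trmx_mul tr_rect_diag mulmxA.
pose P := rect_diag n m s; pose P' := rect_diag m n s.
exists (R^T *m P *m invmx L), (L *m P' *m invmx R^T); split.
(* F M = M^t A amounts to P S = S^t P^t, which holds because P S is a square
diagonal matrix, hence symmetric. *)
- exists (invmx L^T *m P' *m R); rewrite defM -/S trmx_mul.
  rewrite -!mulmxA mulKmx // trmx_mul -!mulmxA mulKVmx //.
  congr (_ *m _); rewrite !mulmxA; congr (_ *m _).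
  by rewrite tr_rect_diag !mul_rect_diag; apply/matrixP => i j;
    rewrite !mxE mulrC.
- exists (invmx R *m P *m L^T); rewrite defM -/S trmx_mul.
  rewrite -!mulmxA mulKmx // trmx_mul mulmxA mulKVmx // -!mulmxA.
  congr (_ *m _); rewrite !mulmxA; congr (_ *m _).
  by rewrite tr_rect_diag !mul_rect_diag; apply/matrixP => i j;
    rewrite !mxE mulrC.
- move=> x y k nz_k kx; rewrite -!mulmxA mulKmx //.
  suff -> : P' *m (P *m (invmx L *m x)) = invmx L *m x by rewrite mulKVmx.
  apply: (rect_diag_support (w := R *m y) nz_k).
  by rewrite scalemxAr kx defM -!mulmxA mulKmx.
move=> z y k nz_k kz; rewrite -!mulmxA mulKmx //.
suff -> : P *m (P' *m (invmx R^T *m z)) = invmx R^T *m z by rewrite mulKVmx.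
apply: (rect_diag_support (w := L^T *m y) nz_k).
by rewrite scalemxAr kz defMT -!mulmxA mulKmx.
Qed.

Lemma absz_unitmx n (U : 'M[int]_n) : U \in unitmx -> `|\det U|%N = 1%N.
Proof.
by rewrite unitmxE => /unitrP[v [/(congr1 absz)/eqP]];
  rewrite abszM muln_eq1 => /andP[_ /eqP].
Qed.

(** Smith normal form reduces the cokernel of M to a product of cyclic groups
of orders |d_i|, whose elements are represented by the remainders modulo d_i.
*)
Lemma card_quotient_det r (M : 'M[int]_r) (A B : zmodType)
    (c : {additive B -> A}) (phi : {additive B -> 'cV[int]_r}) :
    \det M != 0 -> (forall a, exists b, c b = a) ->
    (forall u, exists b, phi b = u) ->
    (forall b, c b = 0 <-> exists y, phi b = M *m y) ->
  finite_group A /\ group_order A = `|\det M|%N.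
Proof.
move=> nz_M surj_c surj_phi ker_c.
have [L uL [R uR [d _]]] := int_Smith_normal_form M.
rewrite -[\matrix_(i, j) _]/(rect_diag r r (fun i => d`_i)) => defM.
have detM : `|\det M|%N = (\prod_(i < r) `|(d`_i)%R|)%N.
  rewrite defM !det_mulmx !abszM (absz_unitmx uL) (absz_unitmx uR) mul1n muln1.
  have -> : rect_diag r r (fun i => d`_i) = diag_mx (\row_i d`_i).
    by apply/matrixP => i j; rewrite !mxE.
  rewrite det_diag (big_morph _ abszM (erefl _)).
  by apply: eq_bigr => i _; rewrite mxE.
have nz_d (i : 'I_r) : d`_i != 0.
  move: nz_M; rewrite -absz_eq0 detM; apply: contraNneq => di0.
  by rewrite (bigD1 i) //= di0 mul0n.
pose T := {dffun forall i : 'I_r, 'I_`|(d`_i)%R|%N}.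
have card_T : #|T| = `|\det M|%N.
  by rewrite detM card_dep_ffun foldrE big_image /=; apply: eq_bigr => i _;
    rewrite card_ord.
pose v (t : T) : 'cV[int]_r := \col_i (t i : nat)%:Z.
have /choice[f fP] : forall t : T, exists a, exists2 b, c b = a &
  phi b = L *m v t.
  by move=> t; have [b] := surj_phi (L *m v t); exists (c b), b.
have ker_c' b b' : c b = c b' <-> exists y, phi b - phi b' = M *m y.
  rewrite -raddfB -ker_c raddfB; split=> [->|/eqP]; first by rewrite subrr.
  by rewrite subr_eq0 => /eqP.
have inj_f : injective f.
  move=> t t'; have [b <- def_b] := fP t; have [b' <- def_b'] := fP t'.
  move/ker_c' => [y]; rewrite def_b def_b' -mulmxBr defM -!mulmxA.
  move/(can_inj (mulKmx uL)); set w := R *m y => eq_w.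
  apply/ffunP => i; have /matrixP/(_ i 0) := eq_w.
  rewrite square_rect_diagE !mxE => eq_i; apply/val_inj/eqP.
  have : (`|(d`_i)%R| %| `|(t i : nat)%:Z - (t' i : nat)%:Z|)%N.
    by rewrite eq_i abszM dvdn_mulr.
  have := ltn_ord (t i); have := ltn_ord (t' i).
  have [|gt0 lt1 lt2 /(dvdn_leq gt0)] :=
    posnP `|(t i : nat)%:Z - (t' i : nat)%:Z|%N.
    by rewrite /=; lia.
  by lia.
have surj_f a : exists t, f t = a.
  have [b <-] := surj_c a.
  have [u def_u] : exists u, phi b = L *m u by exists (invmx L *m phi b);
    rewrite mulKVmx.
  have lt_mod i : (`|(u i 0%R %% d`_i)%Z| < `|(d`_i)%R|)%N.
    have := ltz_mod (u i 0%R) (nz_d i); have := modz_ge0 (u i 0%R) (nz_d i).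
    lia.
  exists [ffun i => Ordinal (lt_mod i)].
  set t : T := finfun _; have [b' <- def_b'] := fP t; apply/ker_c'.
  exists (invmx R *m \col_i - (u i 0%R %/ d`_i)%Z).
  rewrite def_b' def_u -mulmxBr defM -!mulmxA mulKVmx //.
  congr (L *m _); apply/matrixP => i j; rewrite {j}ord1 square_rect_diagE !mxE.
  rewrite ffunE /= gez0_abs ?modz_ge0 //.
  rewrite mulrN mulrC; have := divz_eq (u i 0%R) d`_i.
  lia.
have /choice[g gK] := surj_f.
rewrite -card_T; apply: (finite_group_bij (f := f)); exists g => // t.
exact/inj_f/gK.
Qed.

(** * Gram determinants *)

Section GramDeterminant.
Variables (R : comPzRingType) (r : nat) (E : finType) (N : 'I_r -> E -> R).

Definition gram_mx : 'M_r := \matrix_(i, j) \sum_e N i e * N j e.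

(** The transposed r x r submatrix of N on the columns f 0, ..., f (r - 1),
possibly repeated. *)
Definition selection_mx (f : 'I_r -> E) : 'M_r := \matrix_(i, j) N j (f i).

Lemma det_gram_expand : \det gram_mx =
  \sum_(f : {ffun 'I_r -> E}) (\prod_i N i (f i)) * \det (selection_mx f).
Proof.
transitivity (\sum_(f : {ffun 'I_r -> E}) \sum_(s : 'S_r)
    (-1) ^+ s * \prod_i (N i (f i) * N (s i) (f i))).
  rewrite exchange_big; apply: eq_bigr => /= s _; rewrite -mulr_sumr.
  rewrite -(bigA_distr_bigA (fun i e => N i e * N (s i) e)).
  by congr (_ * _); apply: eq_bigr => i _; rewrite mxE.
apply: eq_bigr => f _; rewrite mulr_sumr; apply: eq_bigr => s _.
rewrite mulrCA big_split; congr (_ * (_ * _)).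
by apply: eq_bigr => i _; rewrite mxE.
Qed.

(** The Cauchy-Binet formula, summed over sequences of columns instead of sets
of columns: every set contributes r! sequences with the same squared minor.
Expanding one of the two determinants over permutations and reindexing the
sequences by each permutation leaves r! equal sums [det_gram_expand]. *)
Lemma sum_sqr_det_selection :
  \sum_(f : {ffun 'I_r -> E}) \det (selection_mx f) ^+ 2 = \det gram_mx *+ r`!.
Proof.
transitivity (\sum_(s : 'S_r) \sum_(f : {ffun 'I_r -> E})
    (-1) ^+ s * (\prod_i N (s i) (f i)) * \det (selection_mx f)).
  rewrite exchange_big; apply: eq_bigr => f _; rewrite expr2 -mulr_suml.
  congr (_ * _); apply: eq_bigr => s _; congr (_ * _).
  by apply: eq_bigr => i _; rewrite mxE.
rewrite -card_Sn -sumr_const.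
apply: eq_big => [s|s _]; first by rewrite inE.
pose comp_perm (t : 'S_r) (f : {ffun 'I_r -> E}) := [ffun i => f (t i)].
have bij_s : bijective (comp_perm s).
  by exists (comp_perm s^-1%g) => f; apply/ffunP => i;
    rewrite !ffunE ?permK ?permKV.
rewrite (reindex (comp_perm s)) /=; last exact: onW_bij.
rewrite det_gram_expand; apply: eq_bigr => f _.
have -> : selection_mx (comp_perm s f) = row_perm s (selection_mx f).
  by apply/matrixP => i j; rewrite !mxE ffunE.
rewrite row_permE det_mulmx det_perm [in LHS]mulrACA -expr2 sqrr_sign mul1r.
congr (_ * _); rewrite [RHS](reindex_inj (@perm_inj _ s)).
by apply: eq_bigr => i _; rewrite ffunE.
Qed.

End GramDeterminant.

(** * Cycles, cuts and forests *)

Definition dot (I : finType) (x y : {ffun I -> int}) : int := \sum_i x i * y i.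

Lemma dotC (I : finType) (x y : {ffun I -> int}) : dot x y = dot y x.
Proof. by apply: eq_bigr => i _; rewrite mulrC. Qed.

Lemma dotBl (I : finType) (x y z : {ffun I ->
  int}) : dot (x - y) z = dot x z - dot y z.
Proof. by rewrite -sumrB; apply: eq_bigr => i _; rewrite !ffunE mulrBl. Qed.

Lemma dotDl (I : finType) (x y z : {ffun I -> int}) :
  dot (x + y) z = dot x z + dot y z.
Proof. by rewrite /dot -big_split; apply: eq_bigr => i _;
  rewrite !ffunE mulrDl. Qed.

Lemma dot_delta (I : finType) (x : {ffun I -> int}) i :
  dot x [ffun j => (j == i)%:R] = x i.
Proof.
rewrite /dot (bigD1 i) //= ffunE eqxx mulr1 big1 ?addr0 // => j /negPf ne_ji.
by rewrite ffunE ne_ji mulr0.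
Qed.

Lemma dot_eq0 (I : finType) (x : {ffun I -> int}) : dot x x = 0 -> x = 0.
Proof.
move=> /eqP; rewrite psumr_eq0 => [/allP x0|i _];
  last by rewrite -expr2 sqr_ge0.
apply/ffunP => i; have /(_ (mem_index_enum i)) := x0 i.
by rewrite mulf_eq0 orbb => /eqP ->; rewrite ffunE.
Qed.

Lemma dot_mulmxv (I J : finType) (M : I -> J -> int) x y :
  dot (mulmxv M x) y = dot x (mulmxv (adjoint_mx id M) y).
Proof.
rewrite /dot; under eq_bigr do rewrite ffunE mulr_suml.
rewrite exchange_big; apply: eq_bigr => j _; rewrite ffunE mulr_sumr.
by apply: eq_bigr => i _; rewrite mulrCA mulrA.
Qed.

Definition bd (G : multigraph) := mulmxv (@boundary G).
Definition cobd (G : multigraph) := mulmxv (adjoint_mx id (@boundary G)).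
HB.instance Definition _ G := GRing.Additive.on (@bd G).
HB.instance Definition _ G := GRing.Additive.on (@cobd G).

Section Forests.
Variable G : multigraph.
Implicit Types (x : {ffun edge G -> int}) (y : {ffun vertex G -> int}).
Implicit Types (d : edge G * bool) (s : seq (edge G * bool)) (F : {set edge G}).

Lemma cobdE y e : cobd y e = y (source e) - y (target e).
Proof.
rewrite ffunE; transitivity (dot y [ffun v =>
  (v == source e)%:R] - dot y [ffun v => (v == target e)%:R]).
  by rewrite -sumrB; apply: eq_bigr => v _; rewrite !ffunE mulrC mulrBr.
by rewrite !dot_delta.
Qed.

Lemma dot_bd x y : dot (bd x) y = dot x (cobd y).
Proof. exact: dot_mulmxv. Qed.

Lemma bd_eq0 x : (forall y, dot x (cobd y) = 0) -> bd x = 0.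
Proof. by move=> x0; apply/ffunP => v; rewrite -dot_delta dot_bd x0 ffunE. Qed.

Lemma cobd_eq0 y : bd (cobd y) = 0 -> cobd y = 0.
Proof.
by move=> y0; apply: dot_eq0; rewrite -dot_bd y0; apply: big1 => v _;
  rewrite ffunE mul0r.
Qed.

(** The integral flow along the darts of s; it lies in the kernel of bd when s
is a closed walk. *)
Definition cycle_vec s : {ffun edge G -> int} :=
  [ffun e => \sum_(d <- s) (-1) ^+ d.2 *+ (d.1 == e)].

Lemma dot_cycle_vec s x : dot (cycle_vec s) x = \sum_(d <- s) (-1) ^+ d.2 * x
  d.1.
Proof.
rewrite /dot; under eq_bigr do rewrite ffunE mulr_suml.
rewrite exchange_big; apply: eq_bigr => d _.
rewrite (bigD1 d.1) //= eqxx mulr1n big1 ?addr0 // => e.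
by rewrite eq_sym => /negPf->; rewrite mul0r.
Qed.

Lemma path_dartsE d s :
  path (fun d d' => dart_end d == dart_start d') d s =
  (map (@dart_start G) s == map (@dart_end G) (belast d s)).
Proof.
by elim: s d => //= d' s IHs d; rewrite eqseq_cons IHs eq_sym.
Qed.

Lemma cycle_dartsE s :
  path.cycle (fun d d' => dart_end d == dart_start d') s =
  (rot 1 (map (@dart_start G) s) == map (@dart_end G) s).
Proof.
by case: s => //= d s; rewrite path_dartsE belast_rcons map_rcons rot1_cons.
Qed.

(** The sum of the potential differences around a closed walk telescopes. *)
Lemma cycle_vec_cobd s y : graph_cycle s -> dot (cycle_vec s) (cobd y) = 0.
Proof.
case/and4P => _ _ _; rewrite cycle_dartsE => /eqP end_s.
transitivity (\sum_(d <- s) (y (dart_start d) - y (dart_end d))).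
  rewrite dot_cycle_vec; apply: eq_bigr => -[e b] _; rewrite cobdE.
  by case: b; rewrite ?mulN1r ?opprB ?mul1r.
rewrite sumrB -(big_map (@dart_start G) xpredT y) -(big_map (@dart_end G)
  xpredT y).
rewrite -end_s [X in _ - X](perm_big (map (@dart_start G) s)) /= ?subrr //.
by rewrite perm_rot.
Qed.

Lemma cycle_vec_mem s e : graph_cycle s -> e \in map fst s ->
  cycle_vec s e != 0.
Proof.
case/and4P => _ uniq_s _ _ /mapP[d s_d ->]; rewrite ffunE.
have perm_s := perm_to_rem s_d; move: (perm_map fst perm_s).
move=> /perm_uniq; rewrite uniq_s /= => /esym/andP[s'd _].
rewrite (perm_big _ perm_s) big_cons eqxx mulr1n big_seq big1 => [|d' s_d'].
  by rewrite /= addr0 signr_eq0.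
case: eqP => // eq_d; case/negP: s'd.
by rewrite -eq_d map_f.
Qed.

Lemma cycle_vec_notin s e : e \notin map fst s -> cycle_vec s e = 0.
Proof.
move=> s'e; rewrite ffunE big_seq big1 // => d s_d; case: eqP => // eq_d.
by case/negP: s'e; rewrite -eq_d map_f.
Qed.

(** By maximality, an edge e outside F closes a cycle with edges of F. The
potential differences along this cycle sum to 0 and vanish on F, so they also
vanish on e, which the cycle traverses once. *)
Lemma cut_eq0 F y : maxset (@forest G) F ->
  (forall e, e \in F -> cobd y e = 0) -> cobd y = 0.
Proof.
move=> maxF y0; apply/ffunP => e; rewrite [RHS]ffunE.
have [/y0 //|F'e] := boolP (e \in F).
have [s cyc_s F_s] : exists2 s, graph_cycle s & all (fun d => d.1 \in e |: F) s.
  apply: contrapT => forestFe; have /maxsetP[_ maxF'] := maxF.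
  case/negP: F'e; rewrite -(maxF' (e |: F)) ?setU11 ?subsetUr //.
  exact/asboolP.
have s_e : e \in map fst s.
  have /maxsetP[/asboolP forF _] := maxF.
  apply/negPn/negP => s'e; apply: forF; exists s => //.
  apply/allP => d s_d; have /allP/(_ d s_d) := F_s.
  by rewrite in_setU1 => /predU1P[eq_e|//]; case/negP: s'e; rewrite -eq_e map_f.
have := cycle_vec_cobd y cyc_s;
  rewrite /dot (bigD1 e) //= big1 => [/eqP|e' ne_e].
  by rewrite addr0 mulf_eq0 (negPf (cycle_vec_mem cyc_s s_e)) => /eqP.
have [/y0->|F'e'] := boolP (e' \in F); first by rewrite mulr0.
rewrite cycle_vec_notin ?mul0r //; apply/mapP => -[d s_d def_e'].
have /allP/(_ d s_d) := F_s.
by rewrite -def_e' in_setU1 (negPf ne_e) (negPf F'e').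
Qed.

Definition edge_adj F (u v : vertex G) : bool :=
  [exists d : edge G * bool, [&& d.1 \in F, dart_start d == u &
    dart_end d == v]].

Lemma dart_endpoint d d' : d.1 = d'.1 ->
  dart_start d = dart_start d' \/ dart_start d = dart_end d'.
Proof.
by case: d d' => [e b] [e' b'] /= <-; case: b b' => [] [];
  [left|right|right|left].
Qed.

(** Distinct vertices force distinct edges: a later dart on the edge of the
first one would return to the initial vertex. *)
Lemma darts_of_path F u p : path (edge_adj F) u p -> uniq (u :: p) ->
  exists2 s, [/\ map (@dart_start G) s = belast u p & map (@dart_end G) s = p]
    & all (fun d => d.1 \in F) s /\ uniq (map fst s).
Proof.
elim: p u => [|v p IHp] u /=; first by move=> _ _; exists [::].
case/andP => /existsP[d /and3P[Fd /eqP start_d /eqP end_d]] path_p.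
case/andP => p'u uniq_p; have [s [start_s end_s] [Fs uniq_s]] :=
  IHp v path_p uniq_p.
exists (d :: s); first by rewrite /= start_d end_d start_s end_s.
split; rewrite /= ?Fd ?uniq_s ?andbT //.
apply/mapP => -[d' s_d' eq_d]; case/negP: p'u; rewrite -start_d inE.
case: (dart_endpoint eq_d) => ->; last by rewrite -end_s map_f ?orbT.
by rewrite -in_cons; apply: mem_belast; rewrite -start_s map_f.
Qed.

(** Otherwise f together with a simple path joining its ends would be a cycle
in F; this includes the case of a loop f, where the path is empty. *)
Lemma forest_separates F f : forest F -> f \in F ->
  ~~ connect (edge_adj (F :\ f)) (source f) (target f).
Proof.
move=> /asboolP forF Ff; apply/negP => /connectP[p0 path_p0 last_p0].
case/shortenP: path_p0 last_p0 => p path_p uniq_p _ last_p {p0}.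
have [s [start_s end_s] [Fs uniq_s]] := darts_of_path path_p uniq_p.
apply: forF; exists ((f, true) :: s); last first.
  rewrite /= Ff; apply: sub_all Fs => d; exact: (subsetP (subD1set F f)).
apply/and4P; split=> //.
- rewrite /= uniq_s andbT; apply/mapP => -[d s_d eq_f].
  by have /allP/(_ d s_d) := Fs; rewrite -eq_f setD11.
- rewrite /= start_s {1}/dart_start /= last_p.
  by rewrite -rcons_uniq -lastI.
- by rewrite cycle_dartsE /= rot1_cons start_s end_s {1}/dart_start /= last_p
    -lastI.
Qed.

Lemma edge_adj_sym F : symmetric (edge_adj F).
Proof.
suff sym u v : edge_adj F u v -> edge_adj F v u by move=> u v; apply/idP/idP;
  apply: sym.
case/existsP => -[e b] /and3P[/= Fe /eqP <- /eqP <-]; apply/existsP.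
by exists (e, ~~ b); rewrite Fe; case: b;
  rewrite /dart_start /dart_end /= !eqxx.
Qed.

(** The indicator of the component of source f in F minus f changes value
along f and along no other edge of F. *)
Lemma forest_potential F f : forest F -> f \in F ->
  exists y, forall e, e \in F -> cobd y e = (e == f)%:R.
Proof.
move=> forF Ff; pose conn := connect (edge_adj (F :\ f)) (source f).
exists [ffun v => (conn v)%:R] => e Fe; rewrite cobdE !ffunE.
have [->|ne_ef] := eqVneq.
  by rewrite /conn connect0 (negPf (forest_separates forF Ff)) subr0.
suff -> : conn (source e) = conn (target e) by rewrite subrr.
have e_adj : edge_adj (F :\ f) (source e) (target e).
  by apply/existsP; exists (e, false); rewrite /= in_setD1 ne_ef Fe !eqxx.
apply: same_connect_r => [|]; first exact/sym_connect_sym/edge_adj_sym.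
exact: connect1.
Qed.

End Forests.

(** * The matrix-tree theorem *)

Section CriticalProjection.
Variables (R : pzRingType) (star : R -> R) (V E : finType) (D : V -> E -> R).

Definition critical_proj (x : {ffun E -> R}) : critical_quotient star D :=
  (\pi x)%qT.

Lemma critical_proj_is_zmod_morphism : zmod_morphism critical_proj.
Proof. by move=> x y; rewrite /critical_proj raddfB. Qed.

HB.instance Definition _ := GRing.isZmodMorphism.Build _ _ critical_proj
  critical_proj_is_zmod_morphism.

Lemma critical_proj_surj a : exists x, critical_proj x = a.
Proof. by exists (generic_quotient.repr a); apply: reprK. Qed.

(** The isomorphism of the critical quotient with im D modulo the image of D
composed with its adjoint. *)
Lemma critical_proj_eq0 x : critical_proj x = 0 <->
  exists y, mulmxv D x = mulmxv D (mulmxv (adjoint_mx star D) y).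
Proof.
have -> : (critical_proj x = 0) <-> critical_relations star D x.
  rewrite -(raddf0 critical_proj); split=> [/eqP|rel_x].
    by rewrite /critical_proj -Quotient.idealrBE subr0.
  by apply/eqP; rewrite /critical_proj -Quotient.idealrBE subr0.
split=> [/asboolP[y [z [Dz ->]]]|[y Dx]].
  by exists y; rewrite raddfD /= Dz addr0.
apply/asboolP; exists y, (x - mulmxv (adjoint_mx star D) y).
by rewrite raddfB /= Dx subrr addrC subrK.
Qed.

End CriticalProjection.

Lemma ffun_mulrzE (I : finType) (x : {ffun I -> int}) (n : int) i :
  (x *~ n) i = n * x i.
Proof.
by case: n => n; rewrite ?NegzE ?mulrNz ?mulNr ?ffunE -?pmulrn ffunMnE
  -mulr_natl natz.
Qed.

Lemma ffun_mulrz_eq0 (I : finType) (x : {ffun I -> int}) (k : int) :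
  k != 0 -> x *~ k = 0 -> x = 0.
Proof.
move=> nz_k /ffunP x0; apply/ffunP => i; apply: (mulfI nz_k).
by rewrite -ffun_mulrzE x0 !ffunE mulr0.
Qed.

Section CutBasis.
Variable G : multigraph.
Implicit Types (x : {ffun edge G -> int}) (y : {ffun vertex G -> int}).

(** The cuts of the potentials Y form the basis of the cut lattice dual to
evaluation on the edges t, as the fundamental cuts of a maximal forest do. *)
Definition cut_basis r (t : 'I_r -> edge G)
    (Y : 'I_r -> {ffun vertex G -> int}) :=
  (forall i j, cobd (Y i) (t j) = (i == j)%:R) /\
  (forall y e, cobd y e = \sum_i cobd y (t i) * cobd (Y i) e).

(** The sequence t is left arbitrary because minors of the cut matrix select
the edges of a forest in every order. *)
Lemma maximal_forest_cut_basis F r (t : 'I_r -> edge G) :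
    maxset (@forest G) F -> injective t -> F = [set t i | i : 'I_r] ->
  exists Y, cut_basis t Y.
Proof.
move=> maxF inj_t def_F; have forF := maxsetp maxF.
have F_t i : t i \in F by rewrite def_F imset_f.
have /choice[Y YP] := fun i => forest_potential forF (F_t i).
have Yt i j : cobd (Y i) (t j) = (i == j)%:R.
  by rewrite YP // (inj_eq inj_t) eq_sym.
exists Y; split=> // y e; apply/eqP; rewrite -subr_eq0.
pose y' := y - \sum_i Y i *~ cobd y (t i).
have cobd_y' e' : cobd y' e' = cobd y e' - \sum_i cobd y (t i) * cobd (Y i) e'.
  rewrite /y' raddfB raddf_sum !ffunE sum_ffunE; congr (_ - _).
  by apply: eq_bigr => i _; rewrite raddfMz ffun_mulrzE.
rewrite -cobd_y' (cut_eq0 maxF) ?ffunE // => e'.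
rewrite def_F => /imsetP[j _ ->]; rewrite cobd_y' (bigD1 j) //= Yt eqxx mulr1.
by rewrite big1 ?addr0 ?subrr // => i /negPf ne_ij; rewrite Yt ne_ij mulr0.
Qed.

Lemma forest0 : forest (set0 : {set edge G}).
Proof.
apply/asboolP => -[[|d s] // /and4P[] // _ _ _ _ /=]; by rewrite in_set0.
Qed.

Lemma maximal_forest_enum F : maxset (@forest G) F ->
  exists (t : 'I_#|F| -> edge G) Y, cut_basis t Y.
Proof.
move=> maxF; exists (@enum_val _ (mem F)).
apply: (maximal_forest_cut_basis maxF) => [|]; first exact: enum_val_inj.
apply/setP => e; apply/idP/imsetP => [Fe|[i _ ->]]; last exact: enum_valP.
by exists (enum_rank_in Fe e); rewrite ?enum_rankK_in.
Qed.

Lemma cut_basis_exists : exists r (t : 'I_r -> edge G) Y, cut_basis t Y.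
Proof.
have [F maxF _] := maxset_exists forest0.
by have [t [Y tY]] := maximal_forest_enum maxF; exists #|F|, t, Y.
Qed.

Definition restrict_mx r r' (Y : 'I_r -> {ffun vertex G -> int})
  (t : 'I_r' -> edge G) : 'M[int]_(r, r') := \matrix_(i, j) cobd (Y i) (t j).

Lemma restrict_mxM r r' (t : 'I_r -> edge G) Y (t' : 'I_r' -> edge G) Y' :
  cut_basis t Y -> cut_basis t' Y' ->
    restrict_mx Y t' *m restrict_mx Y' t = 1%:M.
Proof.
case=> Yt _ [_ spanY']; apply/matrixP => i j; rewrite !mxE -Yt spanY'.
by apply: eq_bigr => k _; rewrite !mxE.
Qed.

(** Two bases are related by mutually inverse matrices of sizes r x r' and r'
x r; the traces of the two products are r and r'. *)
Lemma cut_basis_size r r' (t : 'I_r -> edge G) Y (t' : 'I_r' -> edge G) Y' :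
  cut_basis t Y -> cut_basis t' Y' -> r = r'.
Proof.
move=> tY tY'; have := mxtrace_mulC (restrict_mx Y t') (restrict_mx Y' t).
by rewrite !restrict_mxM // !mxtrace1 => /eqP; rewrite eqr_nat => /eqP.
Qed.

Lemma unit_int_sqr (a b : int) : a * b = 1 -> a ^+ 2 = 1.
Proof.
move=> /(congr1 absz)/eqP; rewrite abszM muln_eq1 => /andP[/eqP a1 _].
have [->|->] : a = 1 \/ a = -1 by lia.
  by rewrite expr1n.
by rewrite sqrrN expr1n.
Qed.

Section Basis.
Variables (r : nat) (t : 'I_r -> edge G) (Y : 'I_r -> {ffun vertex G -> int}).
Hypothesis tY : cut_basis t Y.

Definition cut_fun (i : 'I_r) (e : edge G) : int := cobd (Y i) e.

(** Unimodularity. On a maximal forest the minor is a change of basis between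
two cut bases, hence +1 or -1. Any other set of r edges contains a cycle,
since a forest with r edges is maximal, and the cycle vector is a linear
relation between the columns of the minor. *)
Lemma sqr_det_selection (f : {ffun 'I_r -> edge G}) :
  \det (selection_mx cut_fun f) ^+ 2 =
  (injectiveb f && maxset (@forest G) [set f i | i : 'I_r])%:R.
Proof.
case: injectiveP => [inj_f|not_inj] /=; last first.
  have /injectivePn[i [j ne_ij eq_f]] : ~~ injectiveb f by apply/injectiveP.
  rewrite (determinant_alternate ne_ij) ?expr0n // => k.
  by rewrite !mxE eq_f.
set F := imset _ _; have [maxF|not_maxF] := boolP (maxset _ _).
  have [Y' fY'] := maximal_forest_cut_basis maxF inj_f (erefl _).
  have def_sel : selection_mx cut_fun f = (restrict_mx Y f)^T.
    by apply/matrixP => i j; rewrite !mxE.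
  apply: (@unit_int_sqr _ (\det (restrict_mx Y' t))).
  by rewrite def_sel det_tr -det_mulmx restrict_mxM ?det1.
have not_forF : ~ forest F.
  move=> forF; case/negP: not_maxF; have [F' maxF' sFF'] := maxset_exists forF.
  have [t' [Y' tY']] := maximal_forest_enum maxF'.
  suff -> : F = F' by [].
  apply/eqP; rewrite eqEcard sFF' -(cut_basis_size tY tY').
  by rewrite /F card_imset ?card_ord /=.
have [s cyc_s F_s] : exists2 s, graph_cycle s & all (fun d => d.1 \in F) s.
  by apply: contrapT => no_cyc; apply/not_forF/asboolP.
apply/eqP; rewrite expf_eq0 /=; apply/det0P.
exists (\row_i cycle_vec s (f i)).
  have [d s_d] : exists d, d \in s.
    by case/and4P: cyc_s; case: (s) => [|d s'] // _ _ _ _; exists d;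
      apply: mem_head.
  have /allP/(_ d s_d)/imsetP[i _ def_d] := F_s.
  apply/eqP => /matrixP/(_ 0 i); rewrite !mxE => /eqP.
  by rewrite -def_d (negPf (cycle_vec_mem cyc_s (map_f fst s_d))).
apply/matrixP => i j; rewrite !mxE.
transitivity (dot (cycle_vec s) (cobd (Y j))); last exact: cycle_vec_cobd.
rewrite /dot (bigID (mem F)) /= addrC [X in _ = X + _]big1 ?add0r => [|e F'e];
  last first.
  rewrite cycle_vec_notin ?mul0r //; apply/mapP => -[d s_d def_e].
  by case/negP: F'e; rewrite def_e; apply: (allP F_s).
rewrite big_imset /=; last by move=> k l _ _; apply: inj_f.
by apply: eq_bigr => k _; rewrite !mxE.
Qed.

Lemma card_inj_onto (F : {set edge G}) : #|F| = r ->
  #|[set f : {ffun 'I_r -> edge G} | injectiveb f &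
    [set f i | i : 'I_r] == F]| = r`!.
Proof.
move=> card_F; have <- : #|F| ^_ #|'I_r| = r`! by rewrite card_F card_ord
  ffactnn.
rewrite -card_inj_ffuns_on; apply: eq_card => f; rewrite !inE andbC.
apply: andb_id2r => /injectiveP inj_f; apply/eqP/ffun_onP => [<- i|f_F].
  exact: imset_f.
apply/eqP; rewrite eqEcard card_imset ?card_ord ?card_F ?leqnn ?andbT //.
by apply/subsetP => _ /imsetP[i _ ->].
Qed.

Lemma det_gram_cut : \det (gram_mx cut_fun) = (num_maximal_forests G)%:R.
Proof.
have nz_r : (r`!%:R : int) != 0 by rewrite pnatr_eq0 -lt0n fact_gt0.
apply: (mulIf nz_r); rewrite mulr_natr -sum_sqr_det_selection -natrM.
rewrite (eq_bigr _ (fun f _ => sqr_det_selection f)) -natr_sum; congr _%:R.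
rewrite -big_mkcond /= (partition_big (fun f : {ffun 'I_r -> edge G} =>
  [set f i | i : 'I_r]) (maxset (@forest G))) => [|f /andP[] //] /=.
rewrite /num_maximal_forests -sum1_card big_distrl /=.
apply: eq_big => [F|F maxF]; first by rewrite inE.
have [t' [Y' tY']] := maximal_forest_enum maxF.
rewrite mul1n -(card_inj_onto (esym (cut_basis_size tY tY'))) -sum1_card.
apply: eq_bigl => f; rewrite !inE -andbA; congr (_ && _).
by case: eqP => [->|]; rewrite ?andbF // maxF.
Qed.

Lemma cobd_lin_comb (u : 'I_r -> int) :
  cobd (\sum_i Y i *~ u i) =1 fun e => \sum_i u i * cobd (Y i) e.
Proof.
move=> e; rewrite raddf_sum sum_ffunE.
by apply: eq_bigr => i _; rewrite raddfMz ffun_mulrzE.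
Qed.

Lemma cobd_lin_comb_t (u : 'I_r ->
  int) j : cobd (\sum_i Y i *~ u i) (t j) = u j.
Proof.
have [Yt _] := tY; rewrite cobd_lin_comb (bigD1 j) //= Yt eqxx mulr1.
by rewrite big1 ?addr0 // => i /negPf ne_ij; rewrite Yt ne_ij mulr0.
Qed.

Lemma dot_cobd_span x y :
  dot x (cobd y) = \sum_i cobd y (t i) * dot x (cobd (Y i)).
Proof.
have [_ spanY] := tY; rewrite /dot.
under eq_bigr do rewrite spanY mulr_sumr.
rewrite exchange_big; apply: eq_bigr => i _; rewrite mulr_sumr.
by apply: eq_bigr => e _; rewrite mulrCA.
Qed.

(** The kernel of bd is the orthogonal complement of the cut lattice. *)
Lemma eq_bd x x' : bd x = bd x' <->
  forall i, dot x (cobd (Y i)) = dot x' (cobd (Y i)).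
Proof.
split=> [eq_x i|eq_x]; first by rewrite -!dot_bd eq_x.
apply/eqP; rewrite -subr_eq0 -raddfB /=; apply/eqP/bd_eq0 => y.
by rewrite dot_cobd_span big1 // => i _; rewrite dotBl eq_x subrr mulr0.
Qed.

Definition tree_chain (u : 'I_r -> int) : {ffun edge G -> int} :=
  [ffun e => \sum_i u i * (e == t i)%:R].

Lemma dot_tree_chain u i : dot (tree_chain u) (cobd (Y i)) = u i.
Proof.
have [Yt _] := tY; rewrite /dot; under eq_bigr do rewrite ffunE mulr_suml.
rewrite exchange_big (bigD1 i) //= [X in _ + X]big1 ?addr0 => [|j /negPf ne_ji].
  rewrite (bigD1 (t i)) //= eqxx big1 ?addr0 => [|e /negPf->];
    last by rewrite mulr0 mul0r.
  by rewrite Yt eqxx !mulr1.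
apply: big1 => e _; case: eqP => [->|_]; last by rewrite mulr0 mul0r.
by rewrite Yt eq_sym ne_ji mulr0.
Qed.

(** Pairing with the basic cuts maps Z^E onto Z^r with kernel that of bd, and
maps the cut with coordinates u to the Gram matrix applied to u. *)
Lemma critical_group_order_basis :
  finite_group (critical_group G) /\
  group_order (critical_group G) = num_maximal_forests G.
Proof.
pose phi (x : {ffun edge G -> int}) : 'cV[int]_r := \col_i dot x (cobd (Y i)).
have phiB : zmod_morphism phi.
  by move=> x x'; apply/matrixP => i j; rewrite !mxE dotBl.
pose phiM := GRing.isZmodMorphism.Build _ _ phi phiB.
pose phiA : {additive _ -> _} := HB.pack phi phiM.
have eq_phi x x' : bd x = bd x' <-> phi x = phi x'.
  rewrite eq_bd; split=> [eq_x|/matrixP eq_x i].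
    by apply/matrixP => i j; rewrite !mxE.
  by have := eq_x i 0; rewrite !mxE.
have phi_cobd y : phi (cobd y) = gram_mx cut_fun *m \col_i cobd y (t i).
  apply/matrixP => i j; rewrite !mxE dotC dot_cobd_span.
  by apply: eq_bigr => k _; rewrite !mxE mulrC.
have nz_det : \det (gram_mx cut_fun) != 0.
  rewrite det_gram_cut pnatr_eq0 -lt0n; apply/card_gt0P.
  by have [F maxF _] := maxset_exists forest0; exists F; rewrite inE.
have surj_phi u : exists x, phiA x = u.
  exists (tree_chain (fun i => u i 0)); apply/matrixP => i j.
  by rewrite {j}ord1 mxE dot_tree_chain.
have ker_c x : critical_proj id (@boundary G) x = 0 <->
    exists u, phiA x = gram_mx cut_fun *m u.
  rewrite critical_proj_eq0; split=> [[y /eq_phi eq_x]|[u eq_x]].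
    by exists (\col_i cobd y (t i)); rewrite -phi_cobd.
  exists (\sum_i Y i *~ u i 0); apply/eq_phi;
    rewrite -/(cobd _) phi_cobd [LHS]eq_x.
  congr (_ *m _); apply/matrixP => i j.
  by rewrite {j}ord1 !mxE cobd_lin_comb_t.
have [finK ->] := card_quotient_det nz_det (critical_proj_surj (D :=
  _)) surj_phi ker_c.
by rewrite det_gram_cut natz.
Qed.

Lemma cobd_saturated_basis (k : int) x y : k != 0 -> x *~ k = cobd y ->
  exists y', x = cobd y'.
Proof.
move=> nz_k def_kx; exists (\sum_i Y i *~ x (t i)).
apply/ffunP => e; apply: (mulfI nz_k).
have [_ spanY] := tY.
rewrite cobd_lin_comb -ffun_mulrzE def_kx spanY mulr_sumr.
by apply: eq_bigr => i _; rewrite -def_kx ffun_mulrzE mulrA.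
Qed.

(** If k v = bd x, then the chain on the edges t with coefficients <v, Y_i>
has the pairings of x divided by k with all cuts, hence boundary v. *)
Lemma bd_saturated_basis (k : int) x v : k != 0 -> v *~ k = bd x ->
  exists x', v = bd x'.
Proof.
move=> nz_k def_kv; exists (tree_chain (fun i => dot v (Y i))).
have dotMz (z z' : {ffun vertex G -> int}) : dot (z *~ k) z' = k * dot z z'.
  by rewrite mulr_sumr; apply: eq_bigr => i _; rewrite ffun_mulrzE mulrA.
suff /ffunP eq_v : v *~ k = bd (tree_chain (fun i => dot v (Y i))) *~ k.
  by apply/ffunP => w; apply: (mulfI nz_k); rewrite -!ffun_mulrzE.
rewrite def_kv -raddfMz /=; apply/eq_bd => i.
by rewrite -!dot_bd raddfMz -def_kv !dotMz dot_bd dot_tree_chain.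
Qed.

End Basis.

Lemma critical_group_order :
  finite_group (critical_group G) /\
  group_order (critical_group G) = num_maximal_forests G.
Proof.
by have [r [t [Y tY]]] := cut_basis_exists;
  apply: critical_group_order_basis tY.
Qed.

Lemma cobd_saturated (k : int) x y : k != 0 -> x *~ k = cobd y ->
  exists y', x = cobd y'.
Proof.
move=> nz_k def_k; have [r [t [Y tY]]] := cut_basis_exists.
exact: (cobd_saturated_basis tY nz_k def_k).
Qed.

Lemma bd_saturated (k : int) x v : k != 0 -> v *~ k = bd x ->
  exists x', v = bd x'.
Proof.
move=> nz_k def_k; have [r [t [Y tY]]] := cut_basis_exists.
exact: (bd_saturated_basis tY nz_k def_k).
Qed.

End CutBasis.

(** * Adjoint maps have isomorphic torsion cokernels *)

Section ColumnVectors.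
Variable I : finType.

Definition col_of (x : {ffun I -> int}) : 'cV[int]_#|I| :=
  \col_i x (enum_val i).
Definition ffun_of (u : 'cV[int]_#|I|) : {ffun I -> int} :=
  [ffun i => u (enum_rank i) 0].

Lemma col_ofK : cancel col_of ffun_of.
Proof. by move=> x; apply/ffunP => i; rewrite ffunE mxE enum_rankK. Qed.

Lemma ffun_ofK : cancel ffun_of col_of.
Proof. by move=> u; apply/matrixP => i j;
  rewrite {j}ord1 mxE ffunE enum_valK. Qed.

Lemma col_of_is_zmod_morphism : zmod_morphism col_of.
Proof. by move=> x y; apply/matrixP => i j; rewrite !mxE !ffunE. Qed.
HB.instance Definition _ := GRing.isZmodMorphism.Build _ _ col_of
  col_of_is_zmod_morphism.

Lemma ffun_of_is_zmod_morphism : zmod_morphism ffun_of.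
Proof. by move=> x y; apply/ffunP => i; rewrite !ffunE !mxE. Qed.
HB.instance Definition _ := GRing.isZmodMorphism.Build _ _ ffun_of
  ffun_of_is_zmod_morphism.

Lemma col_of_mulrz x (k : int) : col_of (x *~ k) = k *: col_of x.
Proof. by apply/matrixP => i j; rewrite !mxE ffun_mulrzE. Qed.

End ColumnVectors.

Section SmithAdjoint.
Variables (I J : finType).
Variables (f : {ffun J -> int} -> {ffun I -> int}) (f' : {ffun I -> int} ->
  {ffun J -> int}).
Hypothesis adj_f : forall x y, dot (f x) y = dot x (f' y).

Let delta (K : finType) (k : K) : {ffun K -> int} := [ffun j => (j == k)%:R].
Let M : 'M[int]_(#|I|, #|J|) :=
  \matrix_(i, j) f (delta (enum_val j)) (enum_val i).

Lemma col_of_adjointl x : col_of (f x) = M *m col_of x.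
Proof.
apply/matrixP => i j; rewrite !mxE -dot_delta adj_f /dot.
rewrite (reindex (@enum_val _ (mem J))) /=; last first.
  by apply: onW_bij; apply: enum_val_bij.
apply: eq_bigr => k _; rewrite !mxE mulrC; congr (_ * _).
by rewrite -[LHS]dot_delta dotC -adj_f dot_delta.
Qed.

Lemma col_of_adjointr y : col_of (f' y) = M^T *m col_of y.
Proof.
apply/matrixP => i j; rewrite !mxE -dot_delta dotC -adj_f /dot.
rewrite (reindex (@enum_val _ (mem I))) /=; last first.
  by apply: onW_bij; apply: enum_val_bij.
by apply: eq_bigr => k _; rewrite !mxE.
Qed.

(** [smith_transpose] for a pair of adjoint maps between lattices of integral
functions: F and F' induce inverse isomorphisms between the torsion subgroups
of the cokernels of f and of its adjoint f'. *)
Lemma smith_adjoint :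
  exists (F : {additive {ffun I -> int} -> {ffun J -> int}})
         (F' : {additive {ffun J -> int} -> {ffun I -> int}}),
    [/\ forall x, exists y, F (f x) = f' y,
        forall y, exists x, F' (f' y) = f x,
        forall u x (k : int), k != 0 -> u *~ k = f x -> F' (F u) = u
      & forall w y (k : int), k != 0 -> w *~ k = f' y -> F (F' w) = w].
Proof.
have [A [A' [[B AM] [B' A'M] A'A AA']]] := smith_transpose M.
exists (@ffun_of J \o mulmx A \o @col_of I),
  (@ffun_of I \o mulmx A' \o @col_of J).
split=> [x|y|u x k nz_k def_u|w y k nz_k def_w] /=.
- exists (ffun_of (B *m col_of x)); apply: (can_inj (@col_ofK _)).
  by rewrite col_of_adjointl col_of_adjointr !ffun_ofK !mulmxA AM.
- exists (ffun_of (B' *m col_of y)); apply: (can_inj (@col_ofK _)).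
  by rewrite col_of_adjointl col_of_adjointr !ffun_ofK !mulmxA A'M.
- apply: (can_inj (@col_ofK _)); rewrite !ffun_ofK.
  by apply: (A'A _ (col_of x) k nz_k);
    rewrite -col_of_mulrz def_u col_of_adjointl.
apply: (can_inj (@col_ofK _)); rewrite !ffun_ofK.
by apply: (AA' _ (col_of y) k nz_k);
  rewrite -col_of_mulrz def_w col_of_adjointr.
Qed.

End SmithAdjoint.

(** * Vectors on a covering *)

Lemma dot_inj (I : finType) (x x' : {ffun I -> int}) :
  (forall y, dot x y = dot x' y) -> x = x'.
Proof. by move=> eq_x; apply/ffunP => i; rewrite -!dot_delta eq_x. Qed.

Section Fibers.
Variables (A : finType) (H : finGroupType).

Definition fiber_sum (x : {ffun A * H -> int}) : {ffun A -> int} :=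
  [ffun a => \sum_h x (a, h)].
Definition pull (x : {ffun A -> int}) : {ffun A * H -> int} :=
  [ffun p => x p.1].

Lemma fiber_sum_is_zmod_morphism : zmod_morphism fiber_sum.
Proof.
by move=> x y; apply/ffunP => a; rewrite !ffunE -sumrB; apply: eq_bigr => h _;
  rewrite !ffunE.
Qed.
HB.instance Definition _ := GRing.isZmodMorphism.Build _ _ fiber_sum
  fiber_sum_is_zmod_morphism.

Lemma pull_is_zmod_morphism : zmod_morphism pull.
Proof. by move=> x y; apply/ffunP => a; rewrite !ffunE. Qed.
HB.instance Definition _ := GRing.isZmodMorphism.Build _ _ pull
  pull_is_zmod_morphism.

Lemma fiber_sum_pull x : fiber_sum (pull x) = x *+ #|H|.
Proof.
apply/ffunP => a; rewrite ffunMnE ffunE (eq_bigr (fun _ => x a)) ?sumr_const //.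
by move=> h _; rewrite ffunE.
Qed.

Lemma fiber_sum_surj y : exists x, fiber_sum x = y.
Proof.
exists [ffun p => y p.1 *+ (p.2 == 1%g)]; apply/ffunP => a; rewrite ffunE.
rewrite (bigD1 1%g) //= ffunE eqxx mulr1n big1 ?addr0 // => h /negPf ne_h.
by rewrite ffunE ne_h.
Qed.

Lemma dot_fiber_sum x y : dot (fiber_sum x) y = dot x (pull y).
Proof.
rewrite /dot; under eq_bigr do rewrite ffunE mulr_suml.
by rewrite pair_big; apply: eq_bigr => -[a h] _; rewrite ffunE.
Qed.

Lemma dot_pull x y : dot (pull x) y = dot x (fiber_sum y).
Proof. by rewrite dotC -dot_fiber_sum dotC. Qed.

Definition reduce (x : {ffun A * H -> int}) : {ffun A -> reduced_algebra H} :=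
  [ffun a => reduced_proj ([ffun h => x (a, h)] : group_algebra H)].

Lemma reduce_is_zmod_morphism : zmod_morphism reduce.
Proof.
move=> x y; apply/ffunP => a; rewrite !ffunE -raddfB; congr reduced_proj.
by apply/ffunP => h; rewrite !ffunE.
Qed.
HB.instance Definition _ := GRing.isZmodMorphism.Build _ _ reduce
  reduce_is_zmod_morphism.

Lemma reduce_surj X : exists x, reduce x = X.
Proof.
exists [ffun p => reduced_lift (X p.1) p.2]; apply/ffunP => a; rewrite ffunE.
by rewrite -[RHS]reduced_liftK; congr reduced_proj; apply/ffunP => h;
  rewrite !ffunE.
Qed.

(** The multiples of the norm element are the constant functions on H. *)
Lemma reduce_eq0 x : reduce x = 0 <-> exists x0, x = pull x0.
Proof.
split=> [/ffunP x0|[x0 ->]].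
  have /choice[c xc] a : exists n : int, forall h, x (a, h) = n.
    have := x0 a; rewrite !ffunE -(raddf0 (@reduced_proj H)) => /reduced_projP.
    rewrite subr0 => /norm_multiplesP[n xn]; exists n => h.
    by rewrite -(xn h) ffunE.
  by exists [ffun a => c a]; apply/ffunP => -[a h]; rewrite !ffunE xc.
apply/ffunP => a; rewrite !ffunE -(raddf0 (@reduced_proj H)).
apply/reduced_projP; rewrite subr0; apply/norm_multiplesP; exists (x0 a) => h.
by rewrite !ffunE.
Qed.

End Fibers.
Arguments pull {A} H x.

Section Covering.
Variables (H : finGroupType) (G : multigraph) (beta : edge G -> H).
Local Notation Gt := (covering beta).

Lemma cobd_pull (y : {ffun vertex G -> int}) :
  @cobd Gt (pull H y) = pull H (cobd y).
Proof. by apply/ffunP => -[e h]; rewrite [RHS]ffunE !cobdE !ffunE. Qed.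

(** The targets of the edges over e run through the whole fibre, shifted by
the voltage of e. *)
Lemma cobd_fiber_sum (y : {ffun vertex Gt -> int}) :
  cobd (fiber_sum y) = fiber_sum (@cobd Gt y).
Proof.
apply/ffunP => e; rewrite [RHS]ffunE cobdE !ffunE.
rewrite [X in _ - X](reindex_inj (mulgI (beta e))) -sumrB.
by apply: eq_bigr => h _; rewrite (@cobdE Gt y (e, h)).
Qed.

(** Dual to [cobd_pull]. *)
Lemma bd_fiber_sum (x : {ffun edge Gt -> int}) :
  bd (fiber_sum x) = fiber_sum (@bd Gt x).
Proof.
by apply: dot_inj => y; rewrite dot_bd !dot_fiber_sum -cobd_pull -(@dot_bd Gt).
Qed.

(** Dual to [cobd_fiber_sum]. *)
Lemma bd_pull (x : {ffun edge G -> int}) : @bd Gt (pull H x) = pull H (bd x).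
Proof.
by apply: dot_inj => y; rewrite (@dot_bd Gt) !dot_pull -cobd_fiber_sum -dot_bd.
Qed.

Lemma ga_basis_mulE g (a : group_algebra H) h :
  (ga_basis g * a) h = a (g^-1 * h)%g.
Proof.
rewrite ffunE (bigD1 g) //= ffunE eqxx mul1r big1 ?addr0 // => k /negPf ne_kg.
by rewrite ffunE ne_kg mul0r.
Qed.

(** Left multiplication by T_g translates functions on H by g, so the matrix
of the voltage graph, read over the group algebra itself, is the boundary of
the covering. *)
Lemma voltage_boundary_reduce (x : {ffun edge Gt -> int}) :
  mulmxv (voltage_boundary beta) (reduce x) = reduce (@bd Gt x).
Proof.
apply/ffunP => v; rewrite !ffunE.
pose X e : group_algebra H := [ffun h => x (e, h)].
transitivity (\sum_e reduced_proj (X e *+ (v == source e)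
                   - (ga_basis (beta e) * X e) *+ (v == target e))).
  apply: eq_bigr => e _; rewrite ffunE mulrBl !mulr_natl mulrnAl.
  by rewrite -reduced_projM -!raddfMn -raddfB.
rewrite -raddf_sum; congr reduced_proj; apply/ffunP => h;
  rewrite sum_ffunE ffunE.
transitivity (\sum_e \sum_k @boundary Gt (v, h) (e, k) * x (e, k)); last first.
  by rewrite pair_big [RHS]ffunE; apply: eq_bigr => -[e k].
apply: eq_bigr => e _; rewrite !ffunE !ffunMnE ga_basis_mulE !ffunE.
under eq_bigr do rewrite /boundary mulrBl !xpair_eqE.
rewrite sumrB; congr (_ - _).
  rewrite (bigD1 h) //= eqxx andbT big1 ?addr0 ?mulr_natl // => k /negPf ne_kh.
  by rewrite [h == k]eq_sym ne_kh andbF mul0r.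
rewrite (bigD1 ((beta e)^-1 * h)%g) //= mulKVg eqxx andbT big1 ?addr0
  ?mulr_natl // => k ne_kh.
rewrite (_ : (h == _) = false) ?andbF ?mul0r //; apply/eqP => def_h.
by case/eqP: ne_kh; rewrite def_h mulKg.
Qed.

(** The anti-automorphism T_g |-> T_(g^-1) turns translation by g into its
transpose, translation by the inverse of g. *)
Lemma voltage_adjoint_reduce (y : {ffun vertex Gt -> int}) :
  mulmxv (adjoint_mx (@reduced_star H) (voltage_boundary beta)) (reduce y) =
  reduce (@cobd Gt y).
Proof.
apply/ffunP => e; rewrite !ffunE.
pose Y v : group_algebra H := [ffun h => y (v, h)].
transitivity (\sum_v reduced_proj (Y v *+ (v == source e)
                   - (ga_basis (beta e)^-1 * Y v) *+ (v == target e))).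
  apply: eq_bigr => v _; rewrite ffunE /adjoint_mx.
  have -> : voltage_boundary beta v e = reduced_proj
      (ga_basis 1 *+ (v == source e) - ga_basis (beta e) *+ (v == target e)).
    by rewrite /voltage_boundary mulr_natl -[1]/(reduced_proj 1) raddfB
      !raddfMn.
  have starB (a b : group_algebra H) m n :
      ga_star (a *+ m - b *+ n) = ga_star a *+ m - ga_star b *+ n.
    by apply/ffunP => h; rewrite !(ffunE, ffunMnE).
  rewrite reduced_starE -reduced_projM starB !ga_star_basis invg1;
    congr reduced_proj.
  by rewrite -[ga_basis 1]/(1 : group_algebra H) mulrBl mulr_natl mulrnAl.
rewrite -raddf_sum; congr reduced_proj; apply/ffunP => h.
rewrite sum_ffunE [RHS]ffunE (@cobdE Gt y (e, h)) /=.
transitivity (\sum_v (y (v, h) *+ (v == source e)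
                   - y (v, beta e * h)%g *+ (v == target e))).
  by apply: eq_bigr => v _; rewrite !ffunE !ffunMnE ga_basis_mulE !ffunE invgK.
rewrite sumrB (bigD1 (source e)) //= eqxx big1 ?addr0 => [|v /negPf -> //].
by rewrite (bigD1 (target e)) //= eqxx big1 ?addr0 => [|v /negPf -> //].
Qed.

End Covering.
Arguments bd_fiber_sum {H G} beta x.
Arguments cobd_fiber_sum {H G} beta y.
Arguments bd_pull {H G} beta x.
Arguments cobd_pull {H G} beta y.

(** * The exact sequence of a covering *)

Lemma critical_map (G G' : multigraph)
    (phi : {additive {ffun edge G -> int} -> {ffun edge G' -> int}}) :
    (forall x y, bd x = bd (cobd y) -> exists y', bd (phi x) = bd (cobd y')) ->
  exists g : {additive critical_group G -> critical_group G'},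
    forall x, g (critical_class x) = critical_class (phi x).
Proof.
move=> phi_rel; have [|||g gP] := @additive_of_relation
  (critical_group G) (critical_group G')
  (fun a b => exists2 x, critical_class x = a & critical_class (phi x) = b).
- move=> a; have [x <-] := critical_proj_surj a.
  by exists (critical_class (phi x)), x.
- move=> a a' b b' [x <- <-] [x' <- <-]; exists (x - x').
    exact: (raddfB (critical_proj id (@boundary G))).
  rewrite raddfB; exact: (raddfB (critical_proj id (@boundary G'))).
- by move=> b [x /critical_proj_eq0[y /phi_rel ?] <-]; apply/critical_proj_eq0.
by exists g => x; apply/gP; exists x.
Qed.

Section Covering.
Variables (H : finGroupType) (G : multigraph) (beta : edge G -> H).
Local Notation Gt := (covering beta).
Local Notation Vt := (vertex Gt).

Definition join_vec (v : {ffun Vt -> int}) (e : {ffun edge G -> int}) :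
  {ffun Vt + edge G -> int} :=
  [ffun j => match j with inl w => v w | inr e' => e e' end].

(** The relations that define K(G_beta) as a quotient of im bd on the
covering. *)
Definition voltage_rel (z : {ffun Vt + edge G -> int}) : {ffun Vt -> int} :=
  @bd Gt (@cobd Gt [ffun w => z (inl w)]) + pull H (bd [ffun e => z (inr e)]).

Definition voltage_rel_adj (y : {ffun Vt -> int}) : {ffun Vt + edge G -> int} :=
  join_vec (@bd Gt (@cobd Gt y)) (cobd (fiber_sum y)).

Lemma voltage_rel_adjP z y : dot (voltage_rel z) y = dot z (voltage_rel_adj y).
Proof.
rewrite dotDl (@dot_bd Gt) dotC -(@dot_bd Gt) dotC dot_pull dot_bd.
rewrite /voltage_rel_adj /dot big_sumType /=.
by congr (_ + _); apply: eq_bigr => j _; rewrite [in LHS]ffunE [in RHS]ffunE.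
Qed.

Lemma voltage_rel_join y e :
  voltage_rel (join_vec y e) = @bd Gt (@cobd Gt y) + pull H (bd e).
Proof.
by rewrite /voltage_rel; congr (@bd Gt (@cobd Gt _) + pull H (bd _));
  apply/ffunP => i; rewrite !ffunE.
Qed.

Lemma voltage_rel_im_bd z : exists x, voltage_rel z = @bd Gt x.
Proof.
exists (@cobd Gt [ffun w => z (inl w)] + pull H [ffun e => z (inr e)]).
by rewrite raddfD /= (bd_pull beta).
Qed.

(** A relation in the reduced module lifts up to a vector pull v0 in im bd;
then |H| v0 is the fibre sum of a boundary, so v0 is itself a boundary by
saturation. *)
Lemma voltage_class_eq0 x :
  critical_proj (@reduced_star H) (voltage_boundary beta) (reduce x) = 0 <->
  exists z, @bd Gt x = voltage_rel z.
Proof.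
rewrite critical_proj_eq0; split=> [[Y]|[z def_x]].
  have [y <-] := reduce_surj Y.
  rewrite voltage_adjoint_reduce !voltage_boundary_reduce => /eqP.
  rewrite -subr_eq0 -raddfB => /eqP/reduce_eq0[v0 def_v0].
  have [e0 def_e0] : exists e0, v0 = bd e0.
    apply: (@bd_saturated _ #|H| (fiber_sum (x - @cobd Gt y))).
      by rewrite eqz_nat -lt0n; apply/card_gt0P; exists 1%g.
    by rewrite (bd_fiber_sum beta) raddfB def_v0 fiber_sum_pull pmulrn.
  by exists (join_vec y e0);
    rewrite voltage_rel_join -def_e0 -def_v0 addrC subrK.
exists (reduce ([ffun w => z (inl w)] : {ffun Vt -> int})).
rewrite voltage_adjoint_reduce !voltage_boundary_reduce def_x raddfD /=.
by rewrite (_ : reduce (pull _ _) = 0) ?addr0 //; apply/reduce_eq0; eexists.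
Qed.

Lemma voltage_rel_adj_is_zmod_morphism : zmod_morphism voltage_rel_adj.
Proof.
move=> y y'; rewrite /voltage_rel_adj !raddfB /=.
by apply/ffunP => -[w|e]; rewrite !ffunE.
Qed.
HB.instance Definition _ := GRing.isZmodMorphism.Build _ _ voltage_rel_adj
  voltage_rel_adj_is_zmod_morphism.

Lemma join_vecP w v e k : join_vec v e *~ k = voltage_rel_adj w <->
  v *~ k = @bd Gt (@cobd Gt w) /\ e *~ k = cobd (fiber_sum w).
Proof.
split=> [/ffunP eq_w|[/ffunP eq_v /ffunP eq_e]].
  split; apply/ffunP => i; rewrite ffun_mulrzE.
    by have := eq_w (inl i); rewrite ffun_mulrzE !ffunE.
  by have := eq_w (inr i); rewrite ffun_mulrzE !ffunE.
apply/ffunP => -[i|i]; rewrite ffun_mulrzE ![join_vec _ _ _]ffunE.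
  by rewrite -eq_v ffun_mulrzE.
by rewrite -eq_e ffun_mulrzE.
Qed.

Lemma join_vec1P w v e : join_vec v e = voltage_rel_adj w <->
  v = @bd Gt (@cobd Gt w) /\ e = cobd (fiber_sum w).
Proof. by have := join_vecP w v e 1; rewrite !mulr1z. Qed.

(** A multiple of v has fibre sum bd (cobd w') with w' the fibre sum of w, and
cobd w' = 0 by the second component. *)
Lemma fiber_sum_torsion0 v k w : k != 0 ->
  join_vec v 0 *~ k = voltage_rel_adj w -> fiber_sum v = 0.
Proof.
move=> nz_k /join_vecP[def_v]; rewrite mul0rz => cut0.
apply: (ffun_mulrz_eq0 nz_k); rewrite -raddfMz /= def_v.
by rewrite -(bd_fiber_sum beta) -(cobd_fiber_sum beta) -cut0 raddf0.
Qed.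

(** When v has fibre sum 0, the second relation follows from the first,
because bd is injective on cuts. *)
Lemma fiber_sum0_rel v w : fiber_sum v = 0 -> v = @bd Gt (@cobd Gt w) ->
  join_vec v 0 = voltage_rel_adj w.
Proof.
move=> sum0 def_v; apply/join_vec1P; split=> //; apply/esym/cobd_eq0.
by rewrite (cobd_fiber_sum beta) (bd_fiber_sum beta) -def_v.
Qed.

(** A vector that is torsion modulo the transposed relations has a cut as its
second component, by saturation; lifting this cut to the covering and
subtracting it leaves only the first component, which is a boundary by
saturation again. *)
Lemma voltage_rel_adj_torsion z k y : k != 0 -> z *~ k = voltage_rel_adj y ->
  exists u w, z = join_vec (@bd Gt u) 0 + voltage_rel_adj w.
Proof.
have -> : z = join_vec [ffun v => z (inl v)] [ffun e => z (inr e)].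
  by apply/ffunP => -[v|e]; rewrite !ffunE.
set v := finfun _; set e := finfun _.
move=> nz_k /join_vecP[def_v def_e].
have [y0 def_y0] := cobd_saturated nz_k def_e.
have [w def_w] := fiber_sum_surj H y0.
have [u def_u] : exists u, v - @bd Gt (@cobd Gt w) = @bd Gt u.
  apply: (@bd_saturated Gt k (@cobd Gt y - @cobd Gt w *~ k)) => //.
  by rewrite raddfB raddfMz /= -def_v -mulrzBl.
exists u, w; apply/eqP; rewrite -subr_eq -def_u; apply/eqP.
rewrite /voltage_rel_adj def_w -def_y0.
by apply/ffunP => -[i|i]; rewrite !ffunE ?subrr.
Qed.

(** The class of x in K(G_beta) is represented by bd x modulo the image of
[voltage_rel], a torsion element; F carries it to the torsion of the cokernel
of [voltage_rel_adj], where every class is represented by a vector (bd u, 0)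
with bd u of fibre sum 0. The classes of such u in K(G~) are exactly the
kernel of q. *)
Lemma covering_short_exact
    (q : {additive critical_group Gt -> critical_group G}) :
    (forall x, q (critical_class x) = critical_class (covering_push x)) ->
  exists i : {additive voltage_critical_group beta -> critical_group Gt},
    short_exact i q.
Proof.
move=> qE; pose vclass x :=
  critical_proj (@reduced_star H) (voltage_boundary beta) (reduce x).
have vclassB x x' : vclass (x - x') = vclass x - vclass x'.
  by rewrite /vclass !raddfB.
have vclass_surj a : exists x, vclass x = a.
  have [X <-] := critical_proj_surj a; have [x <-] := reduce_surj X.
  by exists x.
have cclassB x x' :
    critical_class (x - x') = @critical_class Gt x - critical_class x'.
  exact: (raddfB (critical_proj id (@boundary Gt))).
(* The critical group of the covering is finite by the matrix-tree theorem. *)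
have torsion x : exists2 k : int, k != 0 &
    exists y, @bd Gt x *~ k = @bd Gt (@cobd Gt y).
  have [finK _] := critical_group_order Gt.
  have [n n_gt0] := finite_group_torsion (critical_proj id (@boundary Gt) x)
    finK.
  rewrite -raddfMn => /critical_proj_eq0[y def_y].
  by exists n%:Z; [rewrite eqz_nat -lt0n | exists y; rewrite -pmulrn -raddfMn].
have [F [F' [F_rel F'_rel F'F FF']]] := smith_adjoint voltage_rel_adjP.
have rel_cobd y : @bd Gt (@cobd Gt y) = voltage_rel (join_vec y 0).
  by rewrite voltage_rel_join !raddf0 addr0.
have torsion_rel x : exists2 k : int, k != 0 &
    (exists z, @bd Gt x *~ k = voltage_rel z) /\
      (exists y, F (@bd Gt x) *~ k = voltage_rel_adj y).
  have [k nz_k [y def_y]] := torsion x; exists k => //; split.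
    by exists (join_vec y 0); rewrite def_y.
  by rewrite -raddfMz def_y rel_cobd; apply: F_rel.
pose R a b := exists x u w, [/\ vclass x = a, @critical_class Gt u = b &
  F (@bd Gt x) = join_vec (@bd Gt u) 0 + voltage_rel_adj w].
have R_total a : exists b, R a b.
  have [x <-] := vclass_surj a; have [k nz_k [_ [y def_y]]] := torsion_rel x.
  have [u [w def_uw]] := voltage_rel_adj_torsion nz_k def_y.
  by exists (critical_class u), x, u, w.
have R_sub a a' b b' : R a b -> R a' b' -> R (a - a') (b - b').
  move=> [x [u [w [<- <- def_x]]]] [x' [u' [w' [<- <- def_x']]]].
  exists (x - x'), (u - u'), (w - w'); rewrite vclassB cclassB; split=> //.
  rewrite !raddfB /= def_x def_x'; apply/ffunP => -[i|i]; rewrite !ffunE; ring.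
have R_eq0 b : R 0 b -> b = 0.
  move=> [x [u [w [x0 <- def_x]]]].
  have [z def_z] := (voltage_class_eq0 x).1 x0.
  have [y def_y] := F_rel z.
  apply/critical_proj_eq0; exists (y - w); apply: proj1; apply/join_vec1P.
  by rewrite raddfB /= -def_y -def_z def_x addrK.
have R_inj a : R a 0 -> a = 0.
  move=> [x [u [w [<- /critical_proj_eq0[w1 def_u] def_x]]]].
  apply/voltage_class_eq0.
  have [k nz_k [[z def_z] [y def_y]]] := torsion_rel x.
  have sum_u0 : fiber_sum (@bd Gt u) = 0.
    apply: (fiber_sum_torsion0 nz_k (w := y - w *~ k)).
    by rewrite raddfB raddfMz /= -def_y def_x mulrzDl addrK.
  rewrite -(F'F _ _ _ nz_k def_z) def_x (fiber_sum0_rel sum_u0 def_u) -raddfD.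
  exact: F'_rel.
have [i iP] := additive_of_relation R_total R_sub R_eq0; exists i; split.
- move=> a a' eq_a; apply/eqP; rewrite -subr_eq0; apply/eqP/R_inj/iP.
  by rewrite raddfB /= eq_a subrr.
- move=> b; split=> [qb0|[a /iP[x [u [w [_ <- def_x]]]]]]; last first.
    rewrite qE; apply/critical_proj_eq0; exists 0; rewrite !raddf0.
    have [k nz_k [_ [y def_y]]] := torsion_rel x.
    rewrite -/(bd _) (bd_fiber_sum beta);
      apply: (fiber_sum_torsion0 nz_k (w := y - w *~ k)).
    by rewrite raddfB raddfMz /= -def_y def_x mulrzDl addrK.
  have [u0 def_b] := critical_proj_surj b; move: qb0; rewrite -def_b.
  rewrite -[critical_proj _ _ _]/(critical_class u0) qE =>
    /critical_proj_eq0[y0 def_y0].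
  have [y def_y] := fiber_sum_surj H y0.
  (* Correcting by a cut does not change the class and makes the fibre sum of
  the boundary vanish. *)
  pose u := u0 - @cobd Gt y.
  have class_u : critical_class u = critical_class u0.
    rewrite cclassB [X in _ - X](_ : _ = 0) ?subr0 //.
    by apply/critical_proj_eq0; exists y.
  have sum_u0 : fiber_sum (@bd Gt u) = 0.
    rewrite -(bd_fiber_sum beta) /u !raddfB /= -(cobd_fiber_sum beta) def_y.
    by rewrite [X in X - _]def_y0 subrr.
  have [k nz_k [y1 def_y1]] := torsion u.
  have tors_u : join_vec (@bd Gt u) 0 *~ k = voltage_rel_adj y1.
    apply/join_vecP; split=> //; rewrite mul0rz; apply/esym/cobd_eq0.
    by rewrite (cobd_fiber_sum beta) (bd_fiber_sum beta) -def_y1 raddfMz /=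
      sum_u0 mul0rz.
  have tors_F'u := FF' _ _ _ nz_k tors_u.
  (* The vector F' sends (bd u, 0) to is torsion modulo [voltage_rel], hence a
  boundary by saturation; it represents the preimage of the class of u. *)
  have [x def_x] : exists x, F' (join_vec (@bd Gt u) 0) = @bd Gt x.
    have [z def_z] := F'_rel y1; have [x1 def_x1] := voltage_rel_im_bd z.
    by apply: (@bd_saturated Gt k x1) => //; rewrite -raddfMz tors_u def_z.
  exists (vclass x); apply/iP; exists x, u, 0; split=> //.
  by rewrite (raddf0 voltage_rel_adj) addr0 -def_x.
move=> c; have [x <-] := critical_proj_surj c.
have [x' <-] := fiber_sum_surj H x.
by exists (@critical_class Gt x'); rewrite qE.
Qed.

End Covering.

Theorem theorem1p1 (H : finGroupType) (G : multigraph) (beta : edge G -> H) :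
  [/\ finite_group (voltage_critical_group beta),
      finite_group (critical_group (covering beta))
    & finite_group (critical_group G)] /\
  (exists (i : {additive voltage_critical_group beta ->
                         critical_group (covering beta)})
          (q : {additive critical_group (covering beta) -> critical_group G}),
    [/\ forall x : {ffun edge (covering beta) -> int},
          q (critical_class x) = critical_class (covering_push x),
        short_exact i q
      & forall p : nat, prime p -> ~~ (p %| #|H|)%N ->
          split_short_exact (primary_map p i) (primary_map p q)]) /\
  [/\ group_order (critical_group (covering beta)) =
        num_maximal_forests (covering beta),
      group_order (critical_group G) = num_maximal_forests G
    & group_order (critical_group (covering beta)) =
        (group_order (voltage_critical_group beta) *
         group_order (critical_group G))%N].
Proof.
have [finKt cardKt] := critical_group_order (covering beta).
have [finK cardK] := critical_group_order G.
have [|q qE] := @critical_map (covering beta) G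
    (@fiber_sum (edge G) H : {additive _ -> _}).
  move=> x y def_x; exists (fiber_sum y).
  by rewrite (cobd_fiber_sum beta) !(bd_fiber_sum beta) def_x.
(* Pulling back along the covering gives the map t with q t = |H|. *)
have [|t tE] := @critical_map G (covering beta)
    (@pull (edge G) H : {additive _ -> _}).
  move=> x y def_x; exists (pull H y).
  by rewrite (cobd_pull beta) !(bd_pull beta) def_x.
have [i exact_iq] := covering_short_exact qE.
have finKb : finite_group (voltage_critical_group beta).
  by have [inj_i _ _] := exact_iq; apply: finite_group_inj inj_i finKt.
split; first by split.
split; last by split=> //; apply: group_order_exact exact_iq finKb finK.
exists i, q; split=> // p p_pr p'H;
  apply: (primary_split (t := t) p_pr p'H exact_iq) => c.
have [x <-] := critical_proj_surj c.
rewrite [t _]tE qE [X in critical_class X](@fiber_sum_pull _ H x).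
exact: (raddfMn (critical_proj id (@boundary G))).
Qed.
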